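(* Let $N\ge 1$ and let $g$ be a centrally symmetric interaction kernel on $\mathbb{R}^N$ (with $g(x)=g(-x)$) that is bounded from below, lower semicontinuous and belongs to $L^1_{\rm loc}(\mathbb{R}^N)$. Then the functionals $\mathcal{E}_n$ $\Gamma$-converge to $\mathcal{E}$, as $n\to\infty$, in the space $\mathcal{P}(\mathbb{R}^N)$ endowed with the weak-$*$ topology. That is: (1) for every $\mu\in\mathcal{P}(\mathbb{R}^N)$ and every sequence $\{\mu_n\}\subset\mathcal{P}(\mathbb{R}^N)$ with $\mu_n\to\mu$ weakly-$*$, one has $\mathcal{E}(\mu)\le\liminf_{n\to\infty}\mathcal{E}_n(\mu_n)$; (2) for every $\mu\in\mathcal{P}(\mathbb{R}^N)$ there exists a recovery sequence, i.e. a sequence $\{\mu_n\}\subset\mathcal{P}(\mathbb{R}^N)$ with $\mu_n\to\mu$ weakly-$*$ and $\mathcal{E}(\mu)\ge\limsup_{n\to\infty}\mathcal{E}_n(\mu_n)$. In particular, if $\mathcal{E}(\mu)<+\infty$, then for any recovery sequence $\{\mu_n\}$ of $\mu$ the measure $\mu_n$ is an $n$-discrete probability measure for all $n$ large enough.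
   Context: $\mathcal{P}(\mathbb{R}^N)$ is the set of Borel probability measures on $\mathbb{R}^N$. The kernel $g$ takes real values on $\mathbb{R}^N\setminus\{0\}$ and $g(0)\in(-\infty,+\infty]$. Weak-$*$ convergence $\mu_n\to\mu$ in $\mathcal{P}(\mathbb{R}^N)$ means $\int\phi\,d\mu_n\to\int\phi\,d\mu$ for every continuous compactly supported $\phi:\mathbb{R}^N\to\mathbb{R}$. The continuum energy is $\mathcal{E}(\mu)=\int_{\mathbb{R}^N}\int_{\mathbb{R}^N}g(x-y)\,d\mu(x)\,d\mu(y)\in(-\infty,+\infty]$ for $\mu\in\mathcal{P}(\mathbb{R}^N)$. An $n$-discrete probability measure is a measure of the form $\frac1n\sum_{i=1}^n\delta_{x_i}$ with $x_1,\dots,x_n\in\mathbb{R}^N$ (not necessarily distinct). For $n\ge1$ the discrete energy $\mathcal{E}_n:\mathcal{P}(\mathbb{R}^N)\to(-\infty,+\infty]$ is $$\mathcal{E}_n(\mu)=\frac1{n^2}\sum_{1\le i\ne j\le n}g(x_i-x_j)\quad\text{if }\mu=\frac1n\sum_{i=1}^n\delta_{x_i},$$ and $\mathcal{E}_n(\mu)=+\infty$ if $\mu$ is not $n$-discrete. *)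

(* Defs.v *)
From HB Require Import structures.
From mathcomp Require Import all_boot all_order all_algebra.
From mathcomp Require Import perm.
From mathcomp Require Import all_classical all_reals all_analysis.

Set Implicit Arguments.
Unset Strict Implicit.
Unset Printing Implicit Defensive.

Import Order.TTheory GRing.Theory Num.Theory.
Import numFieldNormedType.Exports.

Local Open Scope classical_set_scope.
Local Open Scope ring_scope.

Definition borel_rV_display : measure_display. Proof. exact. Qed.

(* The Borel sigma-algebra of the topological space 'rV[R]_N. *)
Section borel_rV.
Context {R : realType} {N : nat}.

HB.instance Definition _ := @isMeasurable.Build borel_rV_display 'rV[R]_N
  <<s @open 'rV[R]_N >>
  (@sigma_algebra0 _ setT open) (@sigma_algebraC _ open)
  (@sigma_algebra_bigcup _ setT open).

End borel_rV.

Section borel_rV_theory.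
Context {R : realType} {N : nat}.

Lemma open_measurable_rV (U : set 'rV[R]_N) : open U -> measurable U.
Proof. by move=> oU; apply: sub_gen_smallest. Qed.

Lemma closed_measurable_rV (F : set 'rV[R]_N) : closed F -> measurable F.
Proof.
by move=> cF; rewrite -[F]setCK; apply: measurableC; apply: open_measurable_rV;
   exact: closed_openC.
Qed.

Lemma coord_measurable (i : 'I_N) :
  measurable_fun setT (fun v : 'rV[R]_N => v ord0 i).
Proof.
apply: (measurability (measurable_realfun.RGenOInfty.G (R:=R))); first exact: measurable_realfun.RGenOInfty.measurableE.
move=> _ [_ [x ->] <-]; rewrite setTI; apply: open_measurable_rV.
apply: open_comp; last by rewrite set_itvE; exact: open_gt.
by move=> v _; exact: coord_continuous.
Qed.

Let rcube (p : 'rV[rat]_N * nat) : set 'rV[R]_N :=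
  [set v | forall i, `|v ord0 i - ratr (p.1 ord0 i)| < p.2.+1%:R^-1].

Let open_bigcup_rcube (U : set 'rV[R]_N) : open U ->
  U = \bigcup_(p in [set p | rcube p `<=` U]) rcube p.
Proof.
move=> oU; apply/seteqP; split; last by apply: bigcup_sub => p.
move=> x Ux.
have /nbhs_ballP[_/posnumP[e] xeU] : nbhs x U by exact: open_nbhs_nbhs.
have e20 : 0 < e%:num / 2 by [].
have [k _ /(_ k (leqnn k)) ke] := near_infty_natSinv_lt (PosNum e20).
have Hq i : exists q : rat, `|x ord0 i - ratr q| < k.+1%:R^-1.
  have [|q] := @rat_in_itvoo _ (x ord0 i - k.+1%:R^-1) (x ord0 i + k.+1%:R^-1).
    by rewrite ltrBlDr -addrA ltrDl addr_gt0.
  by rewrite in_itv/= => xq; exists q; rewrite distrC ltr_distl.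
have [q Hxq] := choice Hq.
exists (\row_i q i, k); last by move=> i/=; rewrite mxE.
move=> y /= yq; apply: xeU; rewrite /ball/=; split => // a i; rewrite ord1 /ball/=.
move: (yq i); rewrite mxE => yqi.
rewrite (le_lt_trans (ler_distD (ratr (q i)) _ _))//.
by rewrite [ltRHS]splitr ltrD//; [|rewrite distrC]; apply: lt_trans ke.
Qed.

Lemma measurable_fun_rVP d (T : measurableType d) (f : T -> 'rV[R]_N) :
  measurable_fun setT f <->
  forall i, measurable_fun setT (fun t => f t ord0 i).
Proof.
split=> [mf i|mf]; first exact: measurableT_comp (coord_measurable i) mf.
apply: (measurability (@open 'rV[R]_N)) => // _ [U oU <-].
rewrite setTI (open_bigcup_rcube oU) preimage_bigcup bigcup_mkcond.
apply: countable_bigcupT_measurable => // p; case: ifPn => // _.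
rewrite (_ : _ @^-1` _ = \bigcap_(i in [set: 'I_N])
    (fun t => f t ord0 i) @^-1` ball (ratr (p.1 ord0 i) : R) p.2.+1%:R^-1).
  apply: fin_bigcap_measurable => // i _; rewrite -[X in measurable X]setTI.
  by apply: mf => //; exact: measurable_realfun.measurable_ball.
by apply/seteqP; split=> t /= ft i => [_|]; have := ft i;
   rewrite /ball/= distrC//; exact.
Qed.

End borel_rV_theory.

Section lebesgue_rV.
Context {R : realType}.

Definition cons_rV n (p : measurableTypeR R * 'rV[R]_n) : 'rV[R]_n.+1 :=
  \row_i if unlift ord0 i is Some j then p.2 ord0 j else p.1.

Lemma measurable_cons_rV n : measurable_fun setT (@cons_rV n).
Proof.
apply/measurable_fun_rVP => i; case: (unliftP ord0 i) => [j|] ->.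
  rewrite (_ : (fun _ => _) = (fun v : 'rV[R]_n => v ord0 j) \o snd).
    exact: measurableT_comp (coord_measurable j) measurable_snd.
  by apply/funext => p; rewrite mxE liftK.
rewrite (_ : (fun _ => _) = fst); first exact: measurable_fst.
by apply/funext => p; rewrite mxE unlift_none.
Qed.

Section step.
Context {n : nat} (mu : {sigma_finite_measure set 'rV[R]_n -> \bar R}).
Local Open Scope ereal_scope.

Definition lebesgue_cons : set 'rV[R]_n.+1 -> \bar R :=
  pushforward (lebesgue_measure \x mu) (@cons_rV n).

HB.instance Definition _ := Measure.copy lebesgue_cons
  (measure_function_pushforward__canonical__measure_function_Measure
    (lebesgue_measure \x mu : {measure set _ -> \bar R}) (@measurable_cons_rV n)).

Let lebesgue_cons_sigma_finite : sigma_finite setT lebesgue_cons.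
Proof.
have /sigma_finiteP[F [UF ndF Foo]] := sigma_finiteT (@lebesgue_measure R).
have /sigma_finiteP[G [UG ndG Goo]] := sigma_finiteT mu.
pose h (v : 'rV[R]_n.+1) : measurableTypeR R * 'rV[R]_n :=
  (v ord0 ord0, \row_i v ord0 (lift ord0 i)).
have mh : measurable_fun setT h.
  apply: measurable_fun_pair; first exact: coord_measurable.
  apply/measurable_fun_rVP => i.
  rewrite (_ : (fun _ => _) = (fun v : 'rV[R]_n.+1 => v ord0 (lift ord0 i))).
    exact: coord_measurable.
  by apply/funext => v; rewrite mxE.
have hK p : h (cons_rV p) = p.
  case: p => x v; congr pair; first by rewrite mxE unlift_none.
  by apply/rowP => i; rewrite !mxE liftK.
exists (fun k => h @^-1` (F k `*` G k)).
  apply/seteqP; split=> // v _.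
  have [m _ Fm] : (\bigcup_i F i) (h v).1 by rewrite -UF.
  have [k _ Gk] : (\bigcup_i G i) (h v).2 by rewrite -UG.
  exists (maxn m k) => //; split.
    by move: Fm; apply/subsetPset/ndF/leq_maxl.
  by move: Gk; apply/subsetPset/ndG/leq_maxr.
move=> k; have [mFk Fkoo] := Foo k; have [mGk Gkoo] := Goo k; split.
  by rewrite -[X in measurable X]setTI; apply: mh => //; exact: measurableX.
rewrite /lebesgue_cons /pushforward -comp_preimage.
rewrite (_ : h \o _ = id); last by apply/funext => p; exact: hK.
by rewrite preimage_id product_measure1E// lte_mul_pinfty// ge0_fin_numE.
Qed.

HB.instance Definition _ := @Measure_isSigmaFinite.Build _ _ _ lebesgue_cons
  lebesgue_cons_sigma_finite.

End step.

(* Lebesgue measure on R^n: product of n copies of the one-dimensional one,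
   carried to row vectors by [cons_rV]; see [lebesgue_rV_box]. *)
Fixpoint lebesgue_rV (n : nat) : {sigma_finite_measure set 'rV[R]_n -> \bar R} :=
  match n with
  | 0 => \d_(0 : 'rV[R]_0)
  | n'.+1 => lebesgue_cons (lebesgue_rV n')
  end.

Lemma lebesgue_rV_box n (a b : 'rV[R]_n) :
  (forall i, a ord0 i <= b ord0 i) ->
  lebesgue_rV n [set v : 'rV[R]_n | forall i, a ord0 i <= v ord0 i <= b ord0 i] =
  (\prod_(i < n) (b ord0 i - a ord0 i))%:E.
Proof.
elim: n a b => [|n IH] a b ab.
  rewrite big_ord0 /= diracE mem_set//=; case => //.
rewrite big_ord_recl EFinM.
pose tl (v : 'rV[R]_n.+1) : 'rV[R]_n := \row_i v ord0 (lift ord0 i).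
have mbox m (u w : 'rV[R]_m) :
  measurable [set v : 'rV[R]_m | forall i, u ord0 i <= v ord0 i <= w ord0 i].
  rewrite (_ : mkset _ = \bigcap_(i in [set: 'I_m])
    (fun v : 'rV[R]_m => v ord0 i) @^-1` `[u ord0 i, w ord0 i]).
    apply: fin_bigcap_measurable => // i _; rewrite -[X in measurable X]setTI.
    by apply: coord_measurable => //; exact: measurable_itv.
  apply/seteqP; split=> v /= H i => [_|]; first by rewrite /= in_itv/=; exact: H.
  by have := H i I; rewrite /= in_itv.
set A := mkset _.
have AE : @cons_rV n @^-1` A = `[a ord0 ord0, b ord0 ord0]%classic `*`
    [set v : 'rV[R]_n | forall i, tl a ord0 i <= v ord0 i <= tl b ord0 i].
  apply/seteqP; split=> -[x v]/=.
    move=> H; split; first by have := H ord0; rewrite mxE unlift_none in_itv/=.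
    by move=> i; have := H (lift ord0 i); rewrite !mxE liftK.
  rewrite in_itv/= => -[Hx Hv] i; rewrite mxE.
  by case: (unliftP ord0 i) => [j|] -> //; have := Hv j; rewrite !mxE.
transitivity ((@lebesgue_measure R \x lebesgue_rV n)%E (@cons_rV n @^-1` A)) => //.
rewrite AE product_measure1E//; last exact: mbox.
have -> : (\prod_(i < n) (b ord0 (lift ord0 i) - a ord0 (lift ord0 i)))%:E =
    lebesgue_rV n [set v : 'rV[R]_n | forall i, tl a ord0 i <= v ord0 i <= tl b ord0 i].
  rewrite IH; last by move=> i; rewrite !mxE.
  by congr (_%:E); apply: eq_bigr => i _; rewrite !mxE.
congr (_ * _)%E.
have := lebesgue_measure_itv `[a ord0 ord0, b ord0 ord0]; rewrite /= lte_fin => ->.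
by have := ab ord0; rewrite le_eqVlt => /predU1P[->|->//]; rewrite ltxx subrr.
Qed.

End lebesgue_rV.

Section energies.
Context {R : realType} {N : nat}.
Implicit Types (g : 'rV[R]_N -> \bar R) (mu : probability 'rV[R]_N R).
Local Open Scope ereal_scope.

(* The integrals are finite since phi is bounded, so convergence in \bar R is
   convergence of real numbers. *)
Definition weak_star_cvg (mu_ : nat -> probability 'rV[R]_N R) mu : Prop :=
  forall phi : 'rV[R]_N -> R, continuous phi ->
    compact (closure [set x | phi x != 0%R]) ->
    \int[mu_ n]_x (phi x)%:E @[n --> \oo] --> \int[mu]_x (phi x)%:E.

Definition bounded_from_below g : Prop := exists c : R, forall x, c%:E <= g x.

(* Membership in L^1_loc; [integrable] includes measurability. *)
Definition loc_integrable g : Prop :=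
  forall K, compact K -> (lebesgue_rV N).-integrable K g.

Definition energy g mu : \bar R := \int[mu]_y \int[mu]_x g (x - y)%R.

(* mu = 1/n sum_i delta_(x i), as measures on the Borel sets.  For n = 0 the
   right-hand side is the zero measure, so no probability is 0-discrete. *)
Definition is_empirical n (x : 'I_n -> 'rV[R]_N) mu : Prop :=
  forall A, measurable A -> mu A = (n%:R^-1)%:E * \sum_(i < n) \d_(x i) A.

Definition n_discrete n mu : Prop := exists x : 'I_n -> 'rV[R]_N, is_empirical x mu.

Definition pair_energy g n (x : 'I_n -> 'rV[R]_N) : \bar R :=
  ((n%:R ^+ 2)^-1)%:E * \sum_(i < n) \sum_(j < n | j != i) g (x i - x j)%R.

(* The points of an n-discrete measure are unique only up to reordering; the
   value does not depend on the chosen ones, see [discrete_energyE]. *)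
Definition discrete_energy g n mu : \bar R :=
  if pselect (n_discrete n mu) is left d then pair_energy g (projT1 (cid d))
  else +oo.

Lemma discrete_energyE g n mu (x : 'I_n -> 'rV[R]_N) :
  is_empirical x mu -> discrete_energy g n mu = pair_energy g x.
Proof.
move=> hx; rewrite /discrete_energy; case: pselect => [d|nd]; last first.
  by exfalso; apply: nd; exists x.
case: (cid d) => y hy /=; case: n => [|n] in x y hx hy d *.
  by rewrite /pair_energy !big_ord0.
have cnt (z : 'I_n.+1 -> 'rV[R]_N) p : is_empirical z mu ->
    (\sum_(i < n.+1) (z i == p))%N%:R%:E = n.+1%:R%:E * mu [set p].
  move=> ->; last first.
    apply: closed_measurable_rV; apply: accessible_closed_set1.
    exact/hausdorff_accessible/norm_hausdorff.
  rewrite muleA -EFinM divff ?pnatr_eq0// mul1e natr_sum -sumEFin.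
  apply: eq_bigr => i _; rewrite diracE; congr (_%:R%:E).
  by congr nat_of_bool; apply/idP/idP => [/eqP ->|/set_mem /= ->//]; apply/mem_set.
have /tuple_permP[s xs] : perm_eq [tuple y i | i < n.+1] [tuple x i | i < n.+1].
  apply/allP => p _ /=; rewrite !count_map -!sum1_count; apply/eqP.
  rewrite -!enumT !big_enum_cond/= [LHS]big_mkcond [RHS]big_mkcond/=.
  have := cnt y p hy; rewrite -(cnt x p hx) => -[] /eqP; rewrite eqr_nat => /eqP.
  by move=> h; etransitivity; [|etransitivity; [exact: h|]];
    apply: eq_bigr => i _ /=; case: (_ == _).
have yE i : y i = x (s i).
  have : [tuple y i | i < n.+1] = [tuple tnth [tuple x i | i < n.+1] (s i) | i < n.+1].
    exact: val_inj.
  by move=> /(congr1 (fun t => tnth t i)); rewrite !tnth_mktuple.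
rewrite /pair_energy; congr (_ * _).
rewrite [RHS](reindex_inj (@perm_inj _ s)); apply: eq_bigr => i _.
rewrite [RHS](reindex_inj (@perm_inj _ s)); apply: eq_big => j; last by rewrite !yE.
by rewrite (inj_eq perm_inj).
Qed.

End energies.

Section gamma_convergence.
Context {R : realType} {T : Type}.
(* Sequential Gamma-convergence, relative to the given notion of convergence
   of sequences in T. *)
Variable cvg_in_T : (nat -> T) -> T -> Prop.
Variables (F_ : nat -> T -> \bar R) (F : T -> \bar R).
Local Open Scope ereal_scope.

Definition recovery_sequence (u_ : nat -> T) (u : T) : Prop :=
  cvg_in_T u_ u /\ limn_esup (fun n => F_ n (u_ n)) <= F u.

Definition gamma_cvg : Prop :=
  (forall u u_, cvg_in_T u_ u -> F u <= limn_einf (fun n => F_ n (u_ n))) /\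
  (forall u, exists u_, recovery_sequence u_ u).

End gamma_convergence.

(* Main.v *)
From HB Require Import structures.
Require Import Defs.
From mathcomp Require Import all_boot all_order all_algebra.
From mathcomp Require Import all_classical all_reals all_analysis.
From mathcomp Require Import measurable_realfun ring lra.

(* Lower bound: a kernel that is bounded below and lower semicontinuous is, up to
   a constant, the pointwise limit from below of bounded Lipschitz kernels
   (inf-convolutions).  For such a kernel multiplied by compactly supported
   cutoffs the diagonal terms cost O(1/n), and the double integral passes to the
   limit because the potentials of the measures mu_n are equi-Lipschitz, hence
   converge uniformly on compact sets; Fatou's lemma then gives the lower bound.

   Recovery sequence: for n points drawn independently from mu, the expectation of
   the sum of g (x_i - x_j) over i <> j is n (n - 1) E(mu), while the discrepancy
   (mu_n A - mu A)^2 on a set A has expectation at most 1/n.  Hence, for a countable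
   family of sets A_k, the expectation of
     E_n(mu_n) + sqrt n * sum_k 2^-(k+1) (mu_n A_k - mu A_k)^2
   is at most (n - 1)/n E(mu) + 1/sqrt n, and some choice of points does no worse.
   A family of small cells that determines weak-* convergence concludes. *)

Set Implicit Arguments.
Unset Strict Implicit.
Unset Printing Implicit Defensive.

Import Order.TTheory GRing.Theory Num.Theory.
Import numFieldNormedType.Exports.

Local Open Scope classical_set_scope.
Local Open Scope ring_scope.
Local Open Scope ereal_scope.

(** * Greedy choice of points *)

(** The recursion peels off the head, so that prepending a point adds exactly its interaction with
    the points already present. *)
Fixpoint pair_sum (R : realType) (T : Type) (W : T -> T -> \bar R) (s : seq T) :
    \bar R :=
  if s is x :: s' then \sum_(y <- s') W x y + pair_sum W s' else 0.

Section conditional_expectation.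
Context d (T : measurableType d) (R : realType) (P : probability T R).

(** If [h] exceeded its mean everywhere, the mean would be finite and [h] minus its mean would be a
    positive function of integral 0. It would vanish almost everywhere, so the whole space would be
    a null set. *)
Lemma exists_le_integral (h : T -> \bar R) :
  measurable_fun setT h -> (forall x, 0 <= h x) ->
  exists x, h x <= \int[P]_x h x.
Proof.
move=> mh h0; apply: contrapT => /forallNP hI.
have {}hI x : \int[P]_x h x < h x by rewrite ltNge; exact/negP/hI.
have I0 : 0 <= \int[P]_x h x by exact: integral_ge0.
have P1 : P setT = 1 := probability_setT P.
have [x0 _] : [set: T] !=set0.
  by apply/set0P/negP => /eqP T0; move: P1; rewrite T0 measure0 => /eqP;
    rewrite lt_eqF.
have Ifin : \int[P]_x h x \is a fin_num.
  by rewrite ge0_fin_numE// (lt_le_trans (hI x0)) ?leey.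
have mhI : measurable_fun setT (fun x => h x - \int[P]_x h x).
  by apply: emeasurable_funB => //; exact: measurable_cst.
have hI0 x : 0 <= h x - \int[P]_x h x by rewrite sube_ge0 ?Ifin ?orbT//; exact: ltW.
have : \int[P]_x h x = \int[P]_x (h x - \int[P]_x h x) + \int[P]_x h x.
  rewrite -[X in _ + X]mule1 -P1 -(integral_cst P measurableT) -ge0_integralD//.
  by apply: eq_integral => x _; rewrite subeK.
move=> /(congr1 (fun z => z - \int[P]_x h x)).
rewrite subee// addeK// => /esym hI_0.
have : ae_eq P setT (fun x => h x - \int[P]_x h x) (cst 0).
  apply/ae_eq_integral_abs => //; rewrite -[RHS]hI_0.
  by apply: eq_integral => x _; rewrite gee0_abs.
move=> [A [mA PA sA]].
have /eqP : P setT <= P A.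
  rewrite le_measure ?inE// => x _; apply: sA => /= /(_ I) hx.
  by have := hI x; rewrite -sube_gt0 hx ltxx.
by rewrite PA P1 => /eqP; rewrite leNgt lte01.
Qed.

Variable W : T -> T -> \bar R.

Hypothesis mW : measurable_fun setT (fun p : T * T => W p.1 p.2).
Hypothesis W0 : forall x y, 0 <= W x y.

Let U (y : T) : \bar R := \int[P]_x W x y.

Let U0 y : 0 <= U y. Proof. exact: integral_ge0. Qed.

Let mU : measurable_fun setT U.
Proof. exact: (measurable_fun_fubini_tonelli_G (fun p => W p.1 p.2)). Qed.

Let mWr y : measurable_fun setT (W^~ y).
Proof. exact: (measurableT_comp mW (measurable_pair2 y)). Qed.

(* The library's [*+] on \bar R has no distributivity lemmas. *)
Local Notation "x *+ n" := (GRing.natmul x%E n) : ereal_scope.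

Let natmulE (x : \bar R) n : x *+ n = n%:R%:E * x.
Proof. by rewrite mule_natl. Qed.

(** The bound is the expectation of the left side when the entries of [t] are drawn independently
    from [P] with [s] fixed. The list [s] is arbitrary because each chosen point joins it in the
    induction. *)
Let exists_pair_sum_cat (m : nat) (s : seq T) : exists2 t : seq T, size t = m &
  pair_sum W (t ++ s) <= pair_sum W s + (\sum_(y <- s) U y) *+ m +
    (\int[P]_y U y) *+ 'C(m, 2).
Proof.
elim: m s => [|m IH] s; first by exists [::]; rewrite //= !mulr0n !addr0.
(* The part of the conditional expectation that depends on the next point [x]: its interaction with
   [s] and its expected interaction with the [m] points still to come. *)
pose h x := \sum_(y <- s) W x y + U x *+ m.
have Um0 x : 0 <= U x *+ m by rewrite natmulE mule_ge0.
have mUm : measurable_fun setT (fun x => U x *+ m).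
  under eq_fun do rewrite natmulE; exact: measurable_funeM.
have mWs : measurable_fun setT (fun x => \sum_(y <- s) W x y).
  by apply: emeasurable_sum => y _; exact: mWr.
have [|x|x hx] := @exists_le_integral h; [exact: emeasurable_funD| |].
  by rewrite adde_ge0// sume_ge0.
have [t st ht] := IH (x :: s).
exists (rcons t x); first by rewrite size_rcons st.
rewrite cat_rcons (le_trans ht)//= big_cons.
have -> : \sum_(y <- s) W x y + pair_sum W s + (U x + \sum_(y <- s) U y) *+ m +
    (\int[P]_y U y) *+ 'C(m, 2) =
    h x + (pair_sum W s + (\sum_(y <- s) U y) *+ m + (\int[P]_y U y) *+ 'C(m, 2)).
  rewrite /h mulrnDl -!addeA; congr (_ + _).
  by rewrite addeCA.
have -> : pair_sum W s + (\sum_(y <- s) U y) *+ m.+1 +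
    (\int[P]_y U y) *+ 'C(m.+1, 2) =
    (\sum_(y <- s) U y + (\int[P]_y U y) *+ m) +
    (pair_sum W s + (\sum_(y <- s) U y) *+ m + (\int[P]_y U y) *+ 'C(m, 2)).
  rewrite binS bin1 mulrnDr mulrS -!addeA addeCA; congr (_ + _).
  rewrite [RHS]addeCA; congr (_ + _).
  rewrite [RHS]addeCA; congr (_ + _); exact: addeC.
rewrite leeD2r// (le_trans hx)// ge0_integralD//; last first.
  by move=> ? _; rewrite sume_ge0.
rewrite ge0_integral_sum//.
rewrite leeD2l// le_eqVlt; apply/orP; left; apply/eqP.
under eq_integral do rewrite natmulE.
by rewrite ge0_integralZl// natmulE.
Qed.

(* Choosing the points one after the other, each time not exceeding the
   conditional expectation of the final sum. *)
Lemma exists_pair_sum_le (n : nat) : exists2 s : seq T, size s = n &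
  pair_sum W s <= (\int[P]_y \int[P]_x W x y) *+ 'C(n, 2).
Proof.
have [s sn hs] := exists_pair_sum_cat n [::]; exists s => //.
by move: hs; rewrite cats0/= big_nil mul0rn add0e add0e.
Qed.

End conditional_expectation.

(** Symmetrizing the kernel counts each pair of positions in both orders; [x0] is only the default
    of [nth]. *)
Lemma pair_sum_ord (R : realType) (T : Type) (K : T -> T -> \bar R) (x0 : T)
    (s : seq T) :
  pair_sum (fun x y => K x y + K y x) s =
  \sum_(i < size s) \sum_(j < size s | j != i) K (nth x0 s i) (nth x0 s j).
Proof.
elim: s => [|x s IH] /=; first by rewrite big_ord0.
rewrite big_ord_recl/=.
rewrite (_ : \sum_(j < (size s).+1 | j != ord0) _ = \sum_(y <- s) K x y).
  under [X in _ = _ + X]eq_bigr => i _.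
    rewrite big_mkcond big_ord_recl/=.
    under eq_bigr do rewrite (inj_eq lift_inj).
    rewrite -big_mkcond/=; over.
  rewrite [X in _ = _ + X]big_split/= -IH addeA; congr (_ + _).
  by rewrite big_split/=; congr (_ + _); rewrite (big_nth x0) big_mkord.
by rewrite big_mkcond big_ord_recl/= add0e (big_nth x0) big_mkord.
Qed.

(** * Empirical measures and integration against them *)

Section empirical.
Context {R : realType} {N : nat}.

Section empirical_measure.
Variables (n : nat) (x : nat -> 'rV[R]_N).

Let weight_ge0 : (0 <= n.+1%:R^-1 :> R)%R. Proof. by rewrite invr_ge0. Qed.

(** Index [n] stands for [n.+1] points, so that the total mass is always 1. *)
Definition empirical_measure : set 'rV[R]_N -> \bar R :=
  mscale (NngNum weight_ge0) (msum (fun k => \d_(x k)) n.+1).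

HB.instance Definition _ := Measure.on empirical_measure.

Lemma empirical_measureE A :
  empirical_measure A = (n.+1%:R^-1)%:E * \sum_(i < n.+1) \d_(x i) A.
Proof. by []. Qed.

Let empirical_measure_setT : empirical_measure setT = 1.
Proof.
rewrite empirical_measureE.
under eq_bigr do rewrite diracT.
by rewrite sumEFin sumr_const card_ord -EFinM mulVf ?pnatr_eq0.
Qed.

HB.instance Definition _ :=
  Measure_isProbability.Build _ _ _ empirical_measure empirical_measure_setT.

End empirical_measure.

Lemma ge0_integral_empirical n (x : 'I_n -> 'rV[R]_N)
    (mu : probability 'rV[R]_N R) (h : 'rV[R]_N -> \bar R) :
  is_empirical x mu -> measurable_fun setT h -> (forall z, 0 <= h z) ->
  \int[mu]_z h z = (n%:R^-1)%:E * \sum_(i < n) h (x i).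
Proof.
move=> xmu mh h0.
(* [msum] takes a family indexed by [nat], so [x] is extended by the default value 0. *)
pose y k := oapp x 0%R (insub k).
have yE (i : 'I_n) : y i = x i by rewrite /y valK.
have n0 : (0 <= n%:R^-1 :> R)%R by rewrite invr_ge0.
rewrite (eq_measure_integral (mscale (NngNum n0) (msum (fun k => \d_(y k)) n))).
  rewrite ge0_integral_mscale// ge0_integral_measure_sum//=; congr (_ * _).
  by apply: eq_bigr => i _; rewrite integral_dirac// diracT mul1e yE.
move=> A mA _; transitivity (mu A) => //.
rewrite xmu// /mscale/= /msum; congr (_ * _).
by apply: eq_bigr => i _; rewrite yE.
Qed.

End empirical.

(** * Shifting an integrand by a constant *)

Section probability_integral.
Context d (T : measurableType d) (R : realType) (P : probability T R).

Lemma probability_integral_cst (c : \bar R) : \int[P]_x cst c x = c.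
Proof.
rewrite integral_cst//; transitivity (c * P setT) => //.
by rewrite probability_setT mule1.
Qed.

(** The negative part of [g] is at most [c], hence has a finite integral. It can be added to both
    sides, where all integrands become nonnegative, and then subtracted again; the integral of [g]
    may be infinite. *)
Lemma integral_addr_cst (g : T -> \bar R) (c : R) : (0 <= c)%R ->
  measurable_fun setT g -> (forall x, (- c)%:E <= g x) ->
  \int[P]_x (g x + c%:E) = \int[P]_x g x + c%:E.
Proof.
move=> c0 mg gc.
have gc0 x : 0 <= g x + c%:E.
  by rewrite -leeBlDr// sub0e -EFinN.
have gneg x : g^\- x <= c%:E.
  rewrite funenegE ge_max lee_fin c0 andbT.
  by rewrite leeNl -EFinN.
have neg_fin : \int[P]_x g^\- x \is a fin_num.
  rewrite ge0_fin_numE ?integral_ge0//.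
  apply: (@le_lt_trans _ _ (\int[P]_x cst c%:E x)).
    by apply: ge0_le_integral => //; exact: measurable_funeneg.
  by rewrite probability_integral_cst ltey.
have : \int[P]_x (g x + c%:E) + \int[P]_x g^\- x = \int[P]_x g^\+ x + c%:E.
  rewrite -[X in _ = _ + X]probability_integral_cst.
  rewrite -!ge0_integralD//; do ?[exact: measurable_funepos|
    exact: measurable_funeneg|by apply: emeasurable_funD].
  apply: eq_integral => x _; rewrite /cst.
    rewrite funenegE funeposE.
  have := gc x; case: (g x) => [r _|_|//]; last by rewrite maxNye maxye.
  rewrite -EFinN -!EFin_max -!EFinD; congr _%:E.
  by case: (lerP r 0); case: (lerP (- r) 0); lra.
move=> /(congr1 (fun z => z - \int[P]_x g^\- x)).
rewrite addeK// => ->; rewrite [in RHS]integralE addeAC//.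
Qed.

End probability_integral.

(** * Points with small energy and small discrepancy *)

Section quantization.
Context d (T : measurableType d) (R : realType) (P : probability T R).
Variable K : T -> T -> \bar R.
Hypothesis mK : measurable_fun setT (fun p : T * T => K p.1 p.2).
Hypothesis K0 : forall x y, 0 <= K x y.
Variable I : R.
Hypothesis KI : \int[P]_y \int[P]_x K x y = I%:E.

Section null_kernel.
Variables (S : T -> T -> R) (l : R).
Hypothesis l0 : (0 <= l)%R.
Hypothesis mS : measurable_fun setT (fun p : T * T => S p.1 p.2).
Hypothesis S1 : forall x y, (- 1 <= S x y)%R.
Hypothesis SI : forall y, \int[P]_x (1 + S x y)%:E = 1.

(** Since [S] is at least -1 and has mean 0 in its first variable, [l * (1 + S)] is a nonnegative
    kernel of mean [l]. For points whose sum for [K + l * (1 + S)] does not exceed the average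
    [n (n - 1) (I + l)], the constant part [l] cancels. *)
Lemma exists_sum_le_null_kernel (x0 : T) (n : nat) : exists x : nat -> T,
  \sum_(i < n) \sum_(j < n | j != i) K (x i) (x j) <=
  ((n * n.-1)%:R * I - l * \sum_(i < n) \sum_(j < n | j != i) S (x i) (x j))%:E.
Proof.
pose V x y := (l * (1 + S x y))%:E.
pose W x y := K x y + V x y.
have mV : measurable_fun setT (fun p : T * T => V p.1 p.2).
  apply/measurable_EFinP; apply: measurable_funM; first exact: measurable_cst.
  by apply: measurable_funD => //; exact: measurable_cst.
have V0 x y : 0 <= V x y by rewrite lee_fin mulr_ge0//; have := S1 x y; lra.
have mW : measurable_fun setT (fun p : T * T => W p.1 p.2).
  exact: emeasurable_funD.
have W0 x y : 0 <= W x y by rewrite adde_ge0.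
have mWC : measurable_fun setT (fun p : T * T => W p.2 p.1).
  exact: (measurableT_comp mW (@measurable_swap _ _ T T)).
have WI : \int[P]_y \int[P]_x W x y = (I + l)%:E.
  have VI y : \int[P]_x V x y = l%:E.
    under eq_integral do rewrite /V EFinM.
    rewrite ge0_integralZl//; first by rewrite SI mule1.
    - apply/measurable_EFinP; apply: measurable_funD; first exact: measurable_cst.
      exact: (measurableT_comp mS (measurable_pair2 y)).
    - by move=> x _; rewrite lee_fin; have := S1 x y; lra.
  transitivity (\int[P]_y (\int[P]_x K x y + cst l%:E y)).
    apply: eq_integral => y _; rewrite -(VI y) -ge0_integralD//.
      exact: (measurableT_comp mK (measurable_pair2 y)).
    exact: (measurableT_comp mV (measurable_pair2 y)).
  rewrite ge0_integralD//.
  - by rewrite KI probability_integral_cst EFinD.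
  - by move=> y _; exact: integral_ge0.
  - exact: (measurable_fun_fubini_tonelli_G (fun p => K p.1 p.2)).
have WCI : \int[P]_y \int[P]_x W y x = (I + l)%:E.
  by rewrite -WI; exact: (fubini_tonelli (fun p : T * T => W p.1 p.2)).
(* [W] need not be symmetric; the pair sum of its symmetrization runs over all ordered pairs, with
   average ['C(n, 2)] times [2 (I + l)]. *)
have [|x y|s sn] := @exists_pair_sum_le _ _ _ P (fun x y => W x y + W y x) _ _ n.
- exact: emeasurable_funD.
- by rewrite adde_ge0.
rewrite (_ : \int[P]_y _ = (I + l)%:E + (I + l)%:E); last first.
  rewrite -{1}WI -WCI -ge0_integralD//.
  - apply: eq_integral => y _; rewrite ge0_integralD//.
      exact: (measurableT_comp mW (measurable_pair2 y)).
    exact: (measurableT_comp mWC (measurable_pair2 y)).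
  - by move=> y _; exact: integral_ge0.
  - exact: (measurable_fun_fubini_tonelli_G (fun p => W p.1 p.2)).
  - by move=> y _; exact: integral_ge0.
  - exact: (measurable_fun_fubini_tonelli_G (fun p => W p.2 p.1)).
rewrite (pair_sum_ord _ x0) sn => hs; exists (nth x0 s).
set x := nth x0 s in hs *.
have -> : ((n * n.-1)%:R * I -
    l * \sum_(i < n) \sum_(j < n | j != i) S (x i) (x j))%:E
  = ((I + l) *+ (n * n.-1))%:E -
    (\sum_(i < n) \sum_(j < n | j != i) l * (1 + S (x i) (x j)))%:E.
  rewrite -EFinB; congr _%:E.
  have -> : (\sum_(i < n) \sum_(j < n | j != i) l * (1 + S (x i) (x j)) =
      l *+ (n * n.-1) + l * \sum_(i < n) \sum_(j < n | j != i) S (x i) (x j))%R.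
    rewrite mulr_sumr mulnC mulrnA -[X in (_ *+ X)%R]card_ord -sumr_const.
    rewrite -big_split/=.
    apply: eq_bigr => i _.
    rewrite -[in n.-1](card_ord n) -(cardC1 i).
    rewrite -sumr_const mulr_sumr -big_split/=.
    by apply: eq_bigr => j _; rewrite mulrDr mulr1.
  by rewrite mulrnDl mulr_natl; ring.
rewrite leeBrDr// -sumEFin -big_split/=.
rewrite [leLHS](_ : _ = \sum_(i < n) \sum_(j < n | j != i) W (x i) (x j)).
  apply: (le_trans hs).
  have EFin_mulrn (r : R) m : (r%:E *+ m)%R = (r *+ m)%:E by rewrite EFin_natmul.
  rewrite -EFinD EFin_mulrn lee_fin -mulr2n -mulrnA mulnC.
  by rewrite -[X in ('C(n, 2) * X)%N]/(2`!)%N bin_ffact ffactnS ffactn1.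
by apply: eq_bigr => i _; rewrite -sumEFin -big_split.
Qed.

End null_kernel.

Lemma sum_half_pow_le1 (n : nat) : (\sum_(k < n) 2^-1 ^+ k.+1 <= 1 :> R)%R.
Proof.
suff -> : (\sum_(k < n) 2^-1 ^+ k.+1 = 1 - 2^-1 ^+ n :> R)%R.
  by rewrite gerBl exprn_ge0.
elim: n => [|n IH]; first by rewrite big_ord0 expr0 subrr.
by rewrite big_ord_recr/= IH exprS; field.
Qed.

(* The added kernel is positive semidefinite and averages to 0, so minimizing
   on average also controls the discrepancies on the sets [A k]. *)
Lemma exists_quantization (A : nat -> set T) (l : R) (x0 : T) (n : nat) :
  (forall k, measurable (A k)) -> (0 <= l)%R ->
  exists x : nat -> T, forall k, (k < n)%N ->
  \sum_(i < n) \sum_(j < n | j != i) K (x i) (x j) <=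
  ((n * n.-1)%:R * I + l * n%:R - l * (2^-1 ^+ k.+1 *
    (\sum_(i < n) (\1_(A k) (x i) - fine (P (A k)))) ^+ 2))%:E.
Proof.
move=> mA l0.
pose p k := fine (P (A k)).
pose psi k x : R := (\1_(A k) x - p k)%R.
have PA k : P (A k) = (p k)%:E by rewrite fineK ?fin_num_measure.
have p01 k : (0 <= p k <= 1)%R.
  by rewrite -!lee_fin -PA measure_ge0 probability_le1.
have psi1 k x : (`|psi k x| <= 1)%R.
  rewrite ler_norml /psi indicE; have /andP[? ?] := p01 k.
  by case: (_ \in _) => /=; apply/andP; split; lra.
have mpsi k : measurable_fun setT (psi k).
  by apply: measurable_funB; [exact: measurable_indic|exact: measurable_cst].
have ipsi k : P.-integrable setT (EFin \o psi k).
  apply: measurable_bounded_integrable => //.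
  - by rewrite (le_lt_trans (probability_le1 P measurableT)) ?ltey.
  - by exists 1%R; split => // M M1 x _ /=; rewrite (le_trans (psi1 k x))// ltW.
have psi0 k : \int[P]_x (psi k x)%:E = 0.
  rewrite /psi; under eq_integral do rewrite EFinB.
  rewrite integralB_EFin//; last 2 first.
  - exact: integrable_indic.
  - exact: finite_measure_integrable_cst.
  rewrite integral_indic// setIT probability_integral_cst.
  by rewrite (_ : _ (A k) = (p k)%:E) ?subee//; exact: PA.
(* A weighted sum of products of centred indicators; the weights sum to at most 1, which keeps [S]
   between -1 and 1. *)
pose S x y := (\sum_(k < n) 2^-1 ^+ k.+1 * psi k y * psi k x)%R.
have S1 x y : (`|S x y| <= 1)%R.
  rewrite (le_trans _ (sum_half_pow_le1 n))// (le_trans (ler_norm_sum _ _ _))//.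
  apply: ler_sum => k _; rewrite -mulrA normrM ger0_norm ?exprn_ge0//.
  by rewrite ler_piMr ?exprn_ge0// normrM mulr_ile1.
have mS : measurable_fun setT (fun q : T * T => S q.1 q.2).
  apply: measurable_sum => k; apply: measurable_funM; last first.
    exact: (measurableT_comp (mpsi k)).
  by apply: measurable_funM => //; exact: (measurableT_comp (mpsi k)).
have SI y : \int[P]_x (1 + S x y)%:E = 1.
  have iS (k : 'I_n) : P.-integrable setT
      (fun x => (2^-1 ^+ k.+1 * psi k y)%:E * (psi k x)%:E).
    exact: (integrableZl measurableT _ (ipsi k)).
  transitivity (\int[P]_x (cst 1 x +
      \sum_(k < n) (2^-1 ^+ k.+1 * psi k y)%:E * (psi k x)%:E)).
    by apply: eq_integral => x _; rewrite EFinD -sumEFin.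
  rewrite integralD//; last 2 first.
  - exact: finite_measure_integrable_cst.
  - exact: integrable_sum.
  rewrite probability_integral_cst integral_sum// big1 ?adde0// => k _.
  rewrite -[RHS](mule0 (2^-1 ^+ k.+1 * psi k y)%:E) -(psi0 k) -integralZl//.
  exact: (ipsi k).
have [x y|x hx] := exists_sum_le_null_kernel l0 mS _ SI x0 n.
  by have := S1 x y; rewrite ler_norml => /andP[].
exists x => k kn; apply: (le_trans hx); rewrite lee_fin -addrA lerD2l.
rewrite -mulrBr -mulrN ler_wpM2l//.
(* The diagonal is absent from the sum over [j != i]; restoring it costs at most [n], whence the
   term [l * n%:R]. *)
have diag : (\sum_(i < n) S (x i) (x i) <= n%:R)%R.
  rewrite -[n in leRHS]card_ord -sumr_const; apply: ler_sum => i _.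
  by have := S1 (x i) (x i); rewrite ler_norml => /andP[].
(* Over all [i] and [j] the kernel [S] sums to a combination of squares, of which only the one of
   index [k] is kept. *)
have full : (2^-1 ^+ k.+1 * (\sum_(i < n) psi k (x i)) ^+ 2 <=
    \sum_(i < n) \sum_(j < n) S (x i) (x j))%R.
  rewrite [leRHS](_ : _ = \sum_(m < n) 2^-1 ^+ m.+1 *
      (\sum_(i < n) psi m (x i)) ^+ 2)%R.
    rewrite [leRHS](bigD1 (Ordinal kn))//= lerDl sumr_ge0// => m _.
    by rewrite mulr_ge0 ?sqr_ge0// exprn_ge0.
  under eq_bigr do rewrite exchange_big/=.
  rewrite exchange_big/=; apply: eq_bigr => m _.
  rewrite expr2 mulr_suml mulr_sumr; apply: eq_bigr => i _.
  by rewrite mulr_sumr mulr_sumr; apply: eq_bigr => j _; ring.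
have -> : (\sum_(i < n) \sum_(j < n | j != i) S (x i) (x j) =
    \sum_(i < n) \sum_(j < n) S (x i) (x j) - \sum_(i < n) S (x i) (x i))%R.
  rewrite -sumrB; apply: eq_bigr => i _.
  by rewrite [in RHS](bigD1 i)//= addrAC subrr add0r.
move: diag full; rewrite /psi /p; lra.
Qed.

End quantization.

Local Close Scope ereal_scope.

(** * Cells determining weak-* convergence *)

Section bounded_integral.
Context d (T : measurableType d) (R : realType) (P : probability T R).
Implicit Types f g : T -> R.

Lemma bounded_integrable f (M : R) : measurable_fun setT f ->
  (forall x, `|f x| <= M) -> P.-integrable setT (EFin \o f).
Proof.
move=> mf fM; apply: measurable_bounded_integrable => //.
  by rewrite (le_lt_trans (probability_le1 P measurableT)) ?ltey.
exists M; split; first exact: num_real.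
by move=> N MN x _; rewrite /= (le_trans (fM x))// ltW.
Qed.

Lemma EFin_Rintegral f : P.-integrable setT (EFin \o f) ->
  (\int[P]_x (f x)%:E)%E = (\int[P]_x f x)%:E.
Proof. by move=> fi; rewrite fineK//; exact: integrable_fin_num. Qed.

Lemma Rintegral_probability_cst (c : R) : \int[P]_x c = c.
Proof. by rewrite /Rintegral probability_integral_cst. Qed.

Lemma ler_dist_Rintegral f g (e : R) : P.-integrable setT (EFin \o f) ->
  P.-integrable setT (EFin \o g) -> (forall x, `|f x - g x| <= e) ->
  `|\int[P]_x f x - \int[P]_x g x| <= e.
Proof.
move=> fi gi fg.
have fgi : P.-integrable setT (EFin \o (f \- g)).
  by rewrite (_ : _ \o _ = (EFin \o f) \- (EFin \o g))%E//; exact: integrableB.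
rewrite -RintegralB// -[leRHS]Rintegral_probability_cst.
rewrite (le_trans (le_normr_Rintegral _ _))// le_Rintegral//.
  exact: integrable_abse fgi.
exact: finite_measure_integrable_cst.
Qed.

End bounded_integral.

(** * Borel measurability on row vectors *)

Section rV_measurability.
Context {R : realType} {N : nat}.

Lemma continuous_measurable_rV (f : 'rV[R]_N -> R) :
  continuous f -> measurable_fun setT f.
Proof.
move=> cf; apply: (measurability (RGenOInfty.G (R := R))).
  exact: RGenOInfty.measurableE.
move=> _ [_ [x ->] <-]; rewrite setTI; apply: open_measurable_rV.
by apply: open_comp; [move=> v _; exact: cf|rewrite set_itvE; exact: open_gt].
Qed.

Lemma lower_semicontinuous_measurable_rV (f : 'rV[R]_N -> \bar R) :
  lower_semicontinuous f -> measurable_fun setT f.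
Proof.
move=> scif; apply: (measurability _ (ErealGenOInfty.measurableE R)).
move=> /= _ [_ [a ->]] <-; rewrite setTI; apply: open_measurable_rV.
by rewrite preimage_itvoy; move/lower_semicontinuousP : scif; exact.
Qed.

Lemma measurable_subr_rV :
  measurable_fun setT (fun p : 'rV[R]_N * 'rV[R]_N => p.1 - p.2).
Proof.
apply/measurable_fun_rVP => i.
rewrite (_ : (fun _ => _) =
    (fun p : 'rV[R]_N * 'rV[R]_N => p.1 ord0 i - p.2 ord0 i)).
  by apply: measurable_funB; apply: (measurableT_comp (coord_measurable i)).
by apply/funext => p; rewrite !mxE.
Qed.

End rV_measurability.

(** * Partitions into small cells around rational points *)

Section cells.
Context {R : realType} {N : nat}.

Definition rat_point (j : nat) : 'rV[R]_N :=
  if unpickle j is Some v then map_mx ratr (v : 'rV[rat]_N) else 0.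

Lemma rat_point_dense (x : 'rV[R]_N) (e : R) : 0 < e ->
  exists j, ball (rat_point j) e x.
Proof.
move=> e0.
have Hq i : exists q : rat, `|x ord0 i - ratr q| < e.
  have [|q] := @rat_in_itvoo _ (x ord0 i - e) (x ord0 i + e).
    by rewrite ltrBlDr -addrA ltrDl addr_gt0.
  by rewrite in_itv/= => xq; exists q; rewrite distrC ltr_distl.
have [q Hxq] := choice Hq.
exists (pickle (\row_i q i : 'rV[rat]_N)).
rewrite /rat_point pickleK /ball/=; split => // a i.
by rewrite ord1 !mxE /ball/= distrC.
Qed.

(** Making the balls disjoint turns them, for each [k], into a countable Borel partition; every cell
    lies within [k.+1%:R^-1] of its rational point. *)
Definition cell (k : nat) : nat -> set 'rV[R]_N :=
  seqDU (fun j => ball (rat_point j) k.+1%:R^-1).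

Lemma measurable_cell k j : measurable (cell k j).
Proof.
apply: seqDU_measurable => i; apply: open_measurable_rV.
by apply: ball_open; rewrite invr_gt0.
Qed.

(** Compactness gives a uniform radius for [x] in the support. If only [y] lies in the support the
    roles are exchanged, and if neither does both values are 0. *)
Lemma compact_support_unif_continuous (f : 'rV[R]_N -> R) (e : R) :
  continuous f -> compact (closure [set x | f x != 0]) -> 0 < e ->
  exists k, forall x y, ball x k.+1%:R^-1 y -> `|f x - f y| < e.
Proof.
move=> cf /compact_near_coveringP cK e0.
have [|k _ hk] := cK nat \oo
    (fun k x => forall y, ball x k.+1%:R^-1 y -> `|f x - f y| < e) _.
  move=> x _.
  have e20 : 0 < e / 2 by rewrite divr_gt0.
  have /cvgrPdist_lt /(_ _ e20) /nbhs_ballP[r /= r0 hr] := cf x.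
  have r20 : 0 < r / 2 by rewrite divr_gt0.
  exists (ball x (r / 2), [set k | k.+1%:R^-1 < r / 2]); first split => /=.
  - exact: nbhsx_ballx.
  - exact: (near_infty_natSinv_lt (PosNum r20)).
  move=> [x' k] /= [xx' kr] y x'y.
  have xy : ball x r y.
    rewrite [r]splitr; apply: ball_triangle xx' _.
    by apply: le_ball x'y; exact: ltW.
  have {}xx' : ball x r x' by apply: le_ball xx'; lra.
  have := hr _ xx'; have := hr _ xy; rewrite /= => h1 h2.
  rewrite [e]splitr (le_lt_trans (ler_distD (f x) _ _))//.
  by rewrite ltrD// distrC.
have out x : ~ closure [set x | f x != 0] x -> f x = 0.
  by move=> xK; apply: contrapT => /eqP fx; apply: xK; exact: subset_closure.
exists k => x y xy.
have [xK|xK] := pselect (closure [set x | f x != 0] x).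
  exact: hk (leqnn k) _ xK _ xy.
have [yK|yK] := pselect (closure [set x | f x != 0] y).
  by rewrite distrC; apply: (hk _ (leqnn k) _ yK); exact: ball_sym.
by rewrite !out// subrr normr0.
Qed.

(** By compactness the first [J] balls cover the support. On each of the first [J] cells the
    function is within [e] of its value at the rational point; elsewhere it vanishes together with
    the step function. *)
Lemma step_approximation (f : 'rV[R]_N -> R) (e : R) :
  continuous f -> compact (closure [set x | f x != 0]) -> 0 < e ->
  exists k J, forall x,
    `|f x - \sum_(j < J) f (rat_point j) * \1_(cell k j) x| <= e.
Proof.
move=> cf cK e0; have [k hk] := compact_support_unif_continuous cf cK e0.
have [|J _ hJ] := iffLR (compact_near_coveringP _) cK nat \oo
    (fun J x => exists2 j, (j < J)%N & ball (rat_point j) k.+1%:R^-1 x) _.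
  move=> x _; have k0 : 0 < k.+1%:R^-1 :> R by rewrite invr_gt0.
  have [j xj] := rat_point_dense x k0.
  exists (ball (rat_point j) k.+1%:R^-1, [set J | (j < J)%N]); first split => /=.
  - rewrite nbhsE; exists (ball (rat_point j) k.+1%:R^-1) => //.
    by split => //; exact: ball_open.
  - by exists j.+1.
  by move=> [x' J] /= [x'j jJ]; exists j.
exists k, J => x.
have [[j jJ xj]|xJ] := pselect (exists2 j, (j < J)%N & cell k j x).
  rewrite (bigD1 (Ordinal jJ))//= big1 => [|i ij].
    rewrite indicE mem_set// mulr1 addr0 ltW// distrC; apply: hk.
    exact: subset_seqDU xj.
  rewrite indicE memNset ?mulr0// => xi; move/eqP: ij; apply; apply/val_inj => /=.
  by apply: (trivIset_seqDU _ _ _ I I); exists x; split; [exact: xi|exact: xj].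
rewrite big1 => [|j _]; last first.
  by rewrite indicE memNset ?mulr0// => xj; apply: xJ; exists j.
have -> : f x = 0; last by rewrite subrr normr0 ltW.
apply: contrapT => /eqP fx.
have [|j jJ xj] := hJ J (leqnn J) x; first exact: subset_closure.
(* The first [J] cells have the same union as the first [J] balls. *)
have : (\big[setU/set0]_(i < J) cell k i) x.
  rewrite /cell -bigsetU_seqDU.
  by rewrite -(bigcup_mkord _ (fun j => ball (rat_point j) k.+1%:R^-1)); exists j.
by rewrite -bigcup_mkord => -[i iJ xi]; apply: xJ; exists i.
Qed.

(** Integrals of step functions are finite combinations of masses of cells, and a step function
    uniformly close to [phi] has a nearby integral for all probability measures at once. *)
Lemma weak_star_cvg_cells (mu_ : nat -> probability 'rV[R]_N R)
    (mu : probability 'rV[R]_N R) :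
  (forall k j, fine (mu_ n (cell k j)) @[n --> \oo] --> fine (mu (cell k j))) ->
  weak_star_cvg mu_ mu.
Proof.
move=> mucvg phi cphi Kphi.
(* This approximation with tolerance 1 serves to bound [phi]. *)
have [k0 [J0 h0]] := step_approximation cphi Kphi ltr01.
pose s k J x : R := \sum_(j < J) phi (rat_point j) * \1_(cell k j) x.
have si k J (nu : probability 'rV[R]_N R) : nu.-integrable setT (EFin \o s k J).
  apply: (@bounded_integrable _ _ _ _ _ (\sum_(j < J) `|phi (rat_point j)|)).
    apply: measurable_sum => j; apply: measurable_funM => //.
    by apply: measurable_indic; exact: measurable_cell.
  move=> x; rewrite (le_trans (ler_norm_sum _ _ _))//; apply: ler_sum => j _.
  by rewrite normrM ler_piMr// indicE; case: (_ \in _); rewrite ?normr1 ?normr0.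
have sE k J (nu : probability 'rV[R]_N R) :
    \int[nu]_x s k J x = \sum_(j < J) phi (rat_point j) * fine (nu (cell k j)).
  apply: EFin_inj; rewrite -EFin_Rintegral//.
  rewrite -sumEFin; under eq_integral do rewrite -sumEFin.
  rewrite integral_sum//; last first.
    move=> j; under eq_fun do rewrite EFinM.
    apply: integrableZl => //; apply: integrable_indic; exact: measurable_cell.
  apply: eq_bigr => j _; under eq_integral do rewrite EFinM.
  rewrite integralZl//; last by apply: integrable_indic; exact: measurable_cell.
  rewrite integral_indic//; last exact: measurable_cell.
  by rewrite setIT EFinM fineK// fin_num_measure//; exact: measurable_cell.
have phii (nu : probability 'rV[R]_N R) : nu.-integrable setT (EFin \o phi).
  apply: (@bounded_integrable _ _ _ _ _
    (1 + \sum_(j < J0) `|phi (rat_point j)|)).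
    exact: continuous_measurable_rV.
  move=> x; rewrite -[phi x](subrK (s k0 J0 x)) (le_trans (ler_normD _ _))//.
  rewrite lerD//.
  rewrite (le_trans (ler_norm_sum _ _ _))//; apply: ler_sum => j _.
  by rewrite normrM ler_piMr// indicE; case: (_ \in _); rewrite ?normr1 ?normr0.
under eq_cvg do rewrite EFin_Rintegral//.
rewrite EFin_Rintegral//; apply/cvg_EFin; first by near=> n.
apply/cvgrPdist_le => e e0.
have e30 : 0 < e / 3 by rewrite divr_gt0.
have [k [J hkJ]] := step_approximation cphi Kphi e30.
have scvg : \int[mu_ n]_x s k J x @[n --> \oo] --> \int[mu]_x s k J x.
  under eq_cvg do rewrite sE.
  rewrite sE; apply: cvg_big => [|j _]; first exact: add_continuous.
  by apply: cvgMl_tmp; exact: mucvg.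
have close (nu : probability 'rV[R]_N R) :
    `|\int[nu]_x phi x - \int[nu]_x s k J x| <= e / 3.
  exact: ler_dist_Rintegral.
move/cvgrPdist_le : scvg => /(_ _ e30); apply: filterS => n /= hn.
have := close mu; have := close (mu_ n); move: hn.
rewrite !ler_norml => /andP[? ?] /andP[? ?] /andP[? ?].
by apply/andP; split; lra.
Unshelve. all: by end_near. Qed.

End cells.

(** * Recovery sequences *)

Section limits.
Context {R : realType}.
Implicit Types (u v : nat -> \bar R) (l : \bar R).

Lemma limn_esup_le u v l : (\forall n \near \oo, (u n <= v n)%E) ->
  v n @[n --> \oo] --> l -> (limn_esup u <= l)%E.
Proof.
move=> [m _ uv] vl; rewrite -(cvg_limn_einf_sup vl).2 !limn_esup_lim.
apply: lee_lim; [exact: is_cvg_esups|exact: is_cvg_esups|].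
exists m => // n /= mn; apply: ge_ereal_sup => _ [k /= nk <-].
apply: le_trans (uv k _) _; first exact: leq_trans nk.
by apply: ereal_sup_ubound; exists k.
Qed.

Lemma limn_einf_ge u v l : (\forall n \near \oo, (v n <= u n)%E) ->
  v n @[n --> \oo] --> l -> (l <= limn_einf u)%E.
Proof.
move=> vu vl; rewrite /limn_einf leeNr.
apply: (@limn_esup_le _ (fun n => - v n)%E); last exact: cvgeN.
by apply: filterS vu => n /=; rewrite leeN2.
Qed.

(** Otherwise some real number would lie strictly between the lower limit and [l]. *)
Lemma le_limn_einf u l :
  (forall a : R, (a%:E < l)%E -> \forall n \near \oo, (a%:E <= u n)%E) ->
  (l <= limn_einf u)%E.
Proof.
move=> ul; rewrite leNgt; apply/negP => lu.
have [a al ua] : exists2 a : R, (a%:E < l)%E & (limn_einf u < a%:E)%E.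
  move: lu; case: (limn_einf u) => [x| |]; case: l {ul} => [y| |]//.
  - by rewrite lte_fin => xy; exists ((x + y) / 2); rewrite lte_fin; lra.
  - by move=> _; exists (x + 1); rewrite ?ltry// lte_fin; lra.
  - by move=> _; exists (y - 1); rewrite ?ltNyr// lte_fin; lra.
  - by move=> _; exists 0; rewrite ?ltry ?ltNyr.
have : (a%:E <= limn_einf u)%E by exact: limn_einf_ge (ul a al) (cvg_cst _).
by rewrite leNgt ua.
Qed.

Lemma cvg_inv_sqrt : (Num.sqrt n.+1%:R)^-1 @[n --> \oo] --> (0 : R).
Proof.
rewrite -[X in _ --> X]sqrtr0.
under eq_cvg do rewrite -sqrtrV//.
apply: (@cvg_comp _ _ _ harmonic Num.sqrt _ (nbhs 0)).
  exact: cvg_harmonic.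
exact: sqrt_continuous.
Qed.

End limits.

(** * Construction of the recovery sequence *)

Section recovery.
Context {R : realType} {N : nat}.

(** There are [n.+1 * n] ordered pairs for the normalization [n.+1 ^ 2], so the constant enters with
    a factor below 1. *)
Lemma pair_energy_addr (g : 'rV[R]_N -> \bar R) (c : R) n
    (x : 'I_n.+1 -> 'rV[R]_N) :
  (pair_energy (fun z => g z + c%:E) x =
   pair_energy g x + (n%:R / n.+1%:R * c)%:E)%E.
Proof.
rewrite /pair_energy.
have -> : (\sum_(i < n.+1) \sum_(j < n.+1 | j != i) (g (x i - x j)%R + c%:E) =
    (\sum_(i < n.+1) \sum_(j < n.+1 | j != i) g (x i - x j)%R) +
    (n.+1%:R * n%:R * c)%:E)%E.
  rewrite -mulrA mulr_natl mulr_natl -[X in (_ *+ X)%:E](card_ord n.+1) -sumr_const.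
  rewrite -sumEFin -big_split/=.
  apply: eq_bigr => i _; rewrite big_split/=; congr (_ + _)%E.
  by rewrite sumEFin sumr_const cardC1 card_ord.
rewrite muleDr ?fin_num_adde_defl// -EFinM; congr (_ + _%:E)%E.
by field; rewrite addrC natr1 pnatr_eq0.
Qed.

(** Lists the cells of all scales in one sequence. *)
Let test_set (m : nat) : set 'rV[R]_N :=
  if unpickle m is Some (k, j) then cell k j else set0.

Lemma exists_recovery_points (f : 'rV[R]_N -> \bar R) (I : R)
    (mu : probability 'rV[R]_N R) :
  measurable_fun setT f -> (forall z, 0 <= f z)%E -> energy f mu = I%:E ->
  exists x : nat -> nat -> 'rV[R]_N,
    weak_star_cvg (fun n => empirical_measure n (x n)) mu /\
    forall n, (pair_energy f (fun i : 'I_n.+1 => x n i) <=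
      (n%:R / n.+1%:R * I + (Num.sqrt n.+1%:R)^-1)%:E)%E.
Proof.
move=> mf f0 fI.
have mK : measurable_fun setT (fun p : 'rV[R]_N * 'rV[R]_N => f (p.1 - p.2)).
  exact: (measurableT_comp mf measurable_subr_rV).
have mA m : measurable (test_set m).
  rewrite /test_set; case: (unpickle m) => [[k j]|]; last exact: measurable0.
  exact: measurable_cell.
have I0 : 0 <= I.
  rewrite -lee_fin -fI; apply: integral_ge0 => y _; exact: integral_ge0.
(* With this weight the penalty adds only [(l n)^-1] to the energy, and still forces the discrepancy
   on every cell to 0. *)
pose l n : R := Num.sqrt n.+1%:R.
have l1 n : 1 <= l n by rewrite /l -[leLHS]sqrtr1 ler_sqrt// ler1n.
have ll n : l n * l n = n.+1%:R by rewrite -expr2 sqr_sqrtr.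
have l0 n : 0 < l n by exact: lt_le_trans (l1 n).
have [x hx] := choice (fun n => @exists_quantization _ _ _ mu
  (fun a b => f (a - b)) mK (fun a b => f0 _) I fI test_set (l n) 0 n.+1 mA
  (ltW (l0 n))).
exists x; split; last first.
  (* The penalty is nonnegative and is dropped here, so index 0 serves for every [n]. *)
  move=> n; have /= h := hx n 0%N isT.
  rewrite /pair_energy.
  apply: (@le_trans _ _ ((n.+1%:R ^+ 2)^-1%:E *
      ((n.+1 * n)%:R * I + l n * n.+1%:R)%:E)%E).
    rewrite lee_pmul2l// ?lte_fin ?invr_gt0 ?exprn_gt0 ?ltr0n//.
    apply: (le_trans h); rewrite lee_fin gerBl.
    by rewrite mulr_ge0 ?(ltW (l0 n))// mulr_ge0 ?sqr_ge0// exprn_ge0.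
  rewrite -EFinM lee_fin le_eqVlt; apply/orP; left; apply/eqP.
  rewrite natrM -/(l n) -!ll; field.
  by rewrite (gt_eqF (l0 n)).
apply: weak_star_cvg_cells => k j.
pose m := pickle (k, j).
have Am : test_set m = cell k j by rewrite /test_set pickleK.
pose p := fine (mu (cell k j)).
pose q n := fine (empirical_measure n (x n) (cell k j)).
rewrite -/p -/(q _).
(* As the energy is nonnegative, the penalty is at most the rest of the bound, which after division
   by [n.+1 ^ 2] is at most [I + 1]. The power of 2 undoes the weight of the set number [m]. *)
pose C := (I + 1) * 2 ^+ m.+1.
have qp n : (m < n.+1)%N -> (p - q n) ^+ 2 <= C * (l n)^-1.
  move=> mn; have := hx n m mn; rewrite Am -/p.
  have -> : \sum_(i < n.+1) (\1_(cell k j) (x n i) - p) = n.+1%:R * (q n - p).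
    rewrite sumrB sumr_const card_ord -[p *+ _]mulr_natl mulrBr; congr (_ - _).
    rewrite /q empirical_measureE.
    under [in RHS]eq_bigr do rewrite diracE.
    rewrite sumEFin -EFinM/= mulrA divff ?pnatr_eq0// mul1r.
    by apply: eq_bigr => i _; rewrite indicE.
  have s0 : (0 <= \sum_(i < n.+1) \sum_(j < n.+1 | j != i) f (x n i - x n j)%R)%E.
    by apply: sume_ge0 => i _; exact: sume_ge0.
  move=> /(le_trans s0) {s0}; rewrite lee_fin natrM -ll /=.
  set L := l n; set w := 2^-1 ^+ m.+1 => h.
  have [L0 L1] : 0 < L /\ 1 <= L by rewrite l0 l1.
  have nL : n%:R <= L * L :> R by rewrite ll ler_nat.
  have key : L ^+ 4 * (L * w * (p - q n) ^+ 2) <= L ^+ 4 * (I + 1).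
    have h1 : L * L * n%:R * I <= L * L * (L * L) * I.
      by rewrite ler_wpM2r// ler_wpM2l// mulr_ge0// ltW.
    have h2 : L ^+ 3 <= L ^+ 4 by apply: ler_weXn2l.
    move: h h1 h2; lra.
  move: key; rewrite ler_pM2l ?exprn_gt0// => key.
  rewrite ler_pdivlMr// -ler_pdivrMr ?exprn_gt0// -exprVn -/w.
  by move: key; lra.
apply/cvgrPdist_lt => e e0.
have : C * (l n)^-1 @[n --> \oo] --> C * 0 by apply: cvgMl_tmp; exact: cvg_inv_sqrt.
rewrite mulr0 => /cvgrPdist_lt /(_ _ (exprn_gt0 2 e0)) he.
near=> n.
rewrite ltNge; apply/negP => epq.
have h1 : (p - q n) ^+ 2 <= C * (l n)^-1 by apply: qp; near: n; exists m.
have h2 : C * (l n)^-1 < e ^+ 2.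
  by apply: le_lt_trans (ler_norm _) _; rewrite -normrN -sub0r; near: n.
have : e ^+ 2 <= (p - q n) ^+ 2.
  by rewrite -[leRHS]real_normK ?num_real// ler_sqr// ?nnegrE// ltW.
lra.
Unshelve. all: by end_near. Qed.

Lemma energy_addr_cst (g : 'rV[R]_N -> \bar R) (c : R)
    (mu : probability 'rV[R]_N R) : 0 <= c -> measurable_fun setT g ->
  (forall z, (- c)%:E <= g z)%E ->
  energy (fun z => g z + c%:E)%E mu = (energy g mu + c%:E)%E.
Proof.
move=> c0 mg gc.
have mG : measurable_fun setT (fun p : 'rV[R]_N * 'rV[R]_N => g (p.1 - p.2)).
  exact: (measurableT_comp mg measurable_subr_rV).
have inner y : (\int[mu]_x (g (x - y)%R + c%:E) = \int[mu]_x g (x - y)%R + c%:E)%E.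
  apply: integral_addr_cst => //.
  exact: (measurableT_comp mG (measurable_pair2 y)).
have gc0 z : (0 <= g z + c%:E)%E by rewrite -leeBlDr// sub0e -EFinN.
rewrite /energy; under eq_integral do rewrite inner.
apply: integral_addr_cst => //; last first.
  move=> y; rewrite -[leRHS](addeK _ (_ : c%:E \is a fin_num))// -inner.
  by rewrite EFinN -[leLHS]add0e leeD2r// integral_ge0.
(* Tonelli gives measurability for the nonnegative shifted kernel; the potential of [g] inherits it
   by subtracting [c]. *)
rewrite (_ : (fun y => _) =
    (fun y => \int[mu]_x (g (x - y)%R + c%:E) - c%:E)%E); last first.
  by apply/funext => y; rewrite inner addeK.
apply: emeasurable_funB => //.
have mGc : measurable_fun setT
    (fun p : 'rV[R]_N * 'rV[R]_N => g (p.1 - p.2)%R + c%:E)%E.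
  exact: emeasurable_funD.
exact: (measurable_fun_fubini_tonelli_G _ mGc (fun p => gc0 _)).
Qed.

Lemma exists_recovery_sequence (g : 'rV[R]_N -> \bar R) (c : R)
    (mu : probability 'rV[R]_N R) : 0 <= c -> measurable_fun setT g ->
  (forall z, (- c)%:E <= g z)%E ->
  exists mu_, recovery_sequence weak_star_cvg (discrete_energy g) (energy g) mu_ mu.
Proof.
move=> c0 mg gc.
have [Eoo|Egoo] := eqVneq (energy g mu) +oo%E.
  (* At infinite energy the constant sequence is a recovery sequence. *)
  by exists (fun=> mu); split; [move=> phi _ _; exact: cvg_cst|rewrite Eoo leey].
have gc0 z : (0 <= g z + c%:E)%E by rewrite -leeBlDr// sub0e -EFinN.
have Eadd := energy_addr_cst mu c0 mg gc.
have [e Ee] : exists e, energy g mu = e%:E.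
  have : (0 <= energy g mu + c%:E)%E.
    by rewrite -Eadd; apply: integral_ge0 => y _; exact: integral_ge0.
  by move: Egoo; case: (energy g mu) => // e _ _; exists e.
have [x [xmu xe]] := @exists_recovery_points (fun z => g z + c%:E)%E (e + c) mu
  (emeasurable_funD mg (measurable_cst _)) gc0 (etrans Eadd (congr1 (adde^~ _) Ee)).
(* The measure of index [n] must have [n] points, hence the shift; index 0 is a placeholder. *)
pose mu_ n : probability 'rV[R]_N R :=
  if n is m.+1 then empirical_measure m (x m) else mu.
exists mu_; split.
  by move=> phi cphi Kphi; rewrite -cvg_shiftS; exact: xmu.
pose v n : \bar R := (n.-1%:R / n%:R * e + (Num.sqrt n%:R)^-1)%:E.
rewrite Ee; apply: (@limn_esup_le _ _ v).
  exists 1%N => // -[//|n] _.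
  rewrite (@discrete_energyE _ _ _ _ _ (fun i : 'I_n.+1 => x n i)) => [|A mA].
    (* The shift by [c] carries the same factor [n%:R / n.+1%:R] in the discrete energy and in its
       bound, and cancels exactly. *)
    have := xe n; rewrite pair_energy_addr -leeBrDr// => /le_trans; apply.
    by rewrite /v -EFinB lee_fin mulrDr addrAC addrK.
  exact: empirical_measureE.
rewrite -cvg_shiftS; apply: cvg_EFin; first exact: nearW.
rewrite -[X in _ --> X]addr0; apply: cvgD; last exact: cvg_inv_sqrt.
rewrite -[X in _ --> X]mul1r; apply: cvgMr_tmp.
rewrite -[X in _ --> X]subr0 (_ : (fun _ => _) = (fun n => 1 - harmonic n)).
  by apply: cvgB; [exact: cvg_cst|exact: cvg_harmonic].
by apply/funext => n; rewrite /harmonic/=; field; rewrite addrC natr1 pnatr_eq0.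
Qed.

End recovery.

(** * Lower bound *)

Section lipschitz_regularization.
Context {R : realType} {N : nat}.

Lemma lipschitz_continuous_rV (f : 'rV[R]_N -> R) (k : R) :
  (forall x y, `|f x - f y| <= k * `|x - y|) -> continuous f.
Proof.
move=> fk x; apply/(@cvgrPdist_lt _ _ _ (nbhs x) (nbhs_filter x)) => e e0.
have k0 : 0 < `|k| + 1 by rewrite ltr_wpDl.
apply/nbhs_ballP; exists (e / (`|k| + 1)); first by rewrite /= divr_gt0.
move=> y; rewrite -ball_normE /= ltr_pdivlMr// => xy.
rewrite (le_lt_trans (fk _ _))// (le_lt_trans _ xy)// mulrC ler_wpM2l//.
by rewrite (le_trans (ler_norm k))// lerDl.
Qed.

(** For nonnegative [f], the largest [k]-Lipschitz function below [f] truncated at height [k]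
    (Pasch-Hausdorff envelope). The truncation makes it real and bounded even where [f] is
    infinite. *)
Definition inf_conv (f : 'rV[R]_N -> \bar R) (k : nat) (z : 'rV[R]_N) : R :=
  inf [set fine (mine (f w) k%:R%:E) + k%:R * `|z - w| | w in [set: 'rV[R]_N]].

Section inf_conv_theory.
Variable f : 'rV[R]_N -> \bar R.
Hypothesis f0 : forall z, (0 <= f z)%E.

Let p k w := fine (mine (f w) k%:R%:E).

Let pE k w : (p k w)%:E = mine (f w) k%:R%:E.
Proof.
rewrite fineK// ge0_fin_numE; last by rewrite le_min f0 lee_fin ler0n.
by rewrite gt_min ltry orbT.
Qed.

Let p0 k w : 0 <= p k w.
Proof. by rewrite -lee_fin pE le_min f0 lee_fin ler0n. Qed.

Let inf_conv_lbound k z :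
  lbound [set p k w + k%:R * `|z - w| | w in [set: 'rV[R]_N]] 0.
Proof. by move=> _ [w _ <-]; rewrite addr_ge0// mulr_ge0. Qed.

Lemma inf_conv_le k z w :
  inf_conv f k z <= fine (mine (f w) k%:R%:E) + k%:R * `|z - w|.
Proof. by apply: ge_inf; [exists 0; exact: inf_conv_lbound|exists w]. Qed.

Lemma le_inf_conv k z a :
  (forall w, a <= fine (mine (f w) k%:R%:E) + k%:R * `|z - w|) ->
  a <= inf_conv f k z.
Proof.
move=> h; apply: lb_le_inf; first by exists (p k 0 + k%:R * `|z - 0|); exists 0.
by move=> _ [w _ <-]; exact: h.
Qed.

Lemma inf_conv_ge0 k z : 0 <= inf_conv f k z.
Proof. by apply: le_inf_conv => w; rewrite addr_ge0 ?p0// mulr_ge0. Qed.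

Let inf_conv_le_p k z : inf_conv f k z <= p k z.
Proof. by have := inf_conv_le k z z; rewrite subrr normr0 mulr0 addr0. Qed.

Lemma inf_conv_le_nat k z : inf_conv f k z <= k%:R.
Proof.
by rewrite (le_trans (inf_conv_le_p _ _))// -lee_fin pE ge_min lexx orbT.
Qed.

Lemma inf_conv_le_fun k z : ((inf_conv f k z)%:E <= f z)%E.
Proof.
by rewrite (@le_trans _ _ (p k z)%:E)// ?lee_fin// pE ge_min lexx.
Qed.

Lemma inf_conv_lipschitz k x y :
  `|inf_conv f k x - inf_conv f k y| <= k%:R * `|x - y|.
Proof.
have half u v : inf_conv f k u - k%:R * `|u - v| <= inf_conv f k v.
  apply: le_inf_conv => w; rewrite lerBlDr (le_trans (inf_conv_le k u w))//.
  rewrite -addrA lerD2l -mulrDr ler_wpM2l// [leRHS]addrC.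
  exact: ler_distD.
have := half x y; have := half y x; rewrite (distrC y x) ler_norml => ? ?.
by apply/andP; split; lra.
Qed.

Lemma continuous_inf_conv k : continuous (inf_conv f k).
Proof. exact: lipschitz_continuous_rV (inf_conv_lipschitz k). Qed.

(** On a ball of radius [e] around [z] lower semicontinuity keeps [f] above [a]; outside it the
    penalty is at least [k%:R * e]. Both [k] and [k * e] eventually exceed [a]. *)
Lemma inf_conv_eventually_ge (a : R) z : lower_semicontinuous f ->
  (a%:E < f z)%E -> \forall k \near \oo, a <= inf_conv f k z.
Proof.
move=> lscf afz; have [V Vz Va] := lscf z a afz.
have /nbhs_ballP[e /= e0 eV] := Vz.
near=> k; apply: le_inf_conv => w.
have ak : a <= k%:R by near: k; exact: nbhs_infty_ger.
have aek : a <= k%:R * e.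
  by rewrite -ler_pdivrMr//; near: k; exact: nbhs_infty_ger.
have [zw|zw] := ltrP `|z - w| e.
  rewrite (@le_trans _ _ (p k w))//; last by rewrite lerDl mulr_ge0.
  rewrite -lee_fin pE le_min lee_fin ak andbT ltW//; apply/Va/eV.
  by rewrite -ball_normE.
by rewrite (le_trans aek)// ler_wpDl ?p0// ler_wpM2l.
Unshelve. all: by end_near. Qed.

End inf_conv_theory.

Definition cutoff (k : nat) (x : 'rV[R]_N) : R :=
  Num.max 0 (Num.min 1 (k%:R - `|x|)).

Lemma cutoff_ge0 k x : 0 <= cutoff k x.
Proof. by rewrite le_max lexx. Qed.

Lemma cutoff_le1 k x : cutoff k x <= 1.
Proof. by rewrite ge_max ler01 ge_min lexx. Qed.

Lemma continuous_cutoff k : continuous (cutoff k).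
Proof.
apply: (@lipschitz_continuous_rV _ 1) => x y; rewrite mul1r.
have := lerB_dist x y; have := lerB_dist y x; rewrite (distrC y x) => h1 h2.
rewrite ler_norml /cutoff /Num.max /Num.min.
by do !case: ifPn; rewrite -?leNgt => *; apply/andP; split; lra.
Qed.

Lemma cutoff_eventually1 x : \forall k \near \oo, cutoff k x = 1.
Proof.
near=> k; have : `|x| + 1 <= k%:R by near: k; exact: nbhs_infty_ger.
by move=> xk; rewrite /cutoff min_l ?max_r//; lra.
Unshelve. all: by end_near. Qed.

Lemma compact_support_cutoff k : compact (closure [set x | cutoff k x != 0]).
Proof.
have cB : closed [set x : 'rV[R]_N | `|x| <= k%:R].
  apply: (preimage_closed _ (@closed_le _ (k%:R : R))) => x _.
  exact: norm_continuous.
apply: (@subclosed_compact _ _ [set x | `|x| <= k%:R]).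
- exact: closed_closure.
- apply: bounded_closed_compact => //.
  by exists k%:R; split=> [//|M kM x /= xk]; exact: le_trans xk (ltW kM).
- rewrite [X in _ `<=` X](closure_id _).1//.
  apply: closureS => x /=; apply: contraNT; rewrite -ltNge => kx.
  by rewrite /cutoff max_l// ge_min subr_le0 (ltW kx) orbT.
Qed.

End lipschitz_regularization.

Lemma compact_support_mulr (R : realType) (T : topologicalType) (f h : T -> R) :
  compact (closure [set x | f x != 0]) ->
  compact (closure [set x | f x * h x != 0]).
Proof.
move=> cf; apply: (@subclosed_compact _ _ (closure [set x | f x != 0])) => //.
  exact: closed_closure.
by apply: closureS => x /=; apply: contraNN => /eqP ->; rewrite mul0r.
Qed.

(** * Weak-* continuity of the cut-off double integral *)

Section double_integral.
Context {R : realType} {N : nat}.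
Implicit Types nu : probability 'rV[R]_N R.
Variables (phi h : 'rV[R]_N -> R) (k M : R).
Hypotheses (cphi : continuous phi) (Kphi : compact (closure [set x | phi x != 0])).
Hypothesis phi01 : forall x, 0 <= phi x <= 1.
Hypotheses (h0M : forall x, 0 <= h x <= M).
Hypothesis k0 : 0 <= k.
Hypothesis hk : forall x y, `|h x - h y| <= k * `|x - y|.

Definition cut_potential nu (y : 'rV[R]_N) : R := \int[nu]_x (phi x * h (x - y)).

Definition cut_energy nu : R := \int[nu]_y (phi y * cut_potential nu y).

Lemma continuous_cut_kernel (y : 'rV[R]_N) :
  continuous (fun x : 'rV[R]_N => phi x * h (x - y)).
Proof.
have chy : continuous (fun x : 'rV[R]_N => h (x - y)).
  apply: (@lipschitz_continuous_rV _ _ _ k) => a b.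
  by rewrite (le_trans (hk _ _))// opprB addrA subrK.
by move=> x; exact: (continuousM (@cphi x) (chy x)).
Qed.

Let phih_ge0 y x : 0 <= phi x * h (x - y).
Proof.
by rewrite mulr_ge0//; [have /andP[] := phi01 x|have /andP[] := h0M (x - y)].
Qed.

Let phih_leM y x : phi x * h (x - y) <= M.
Proof.
have /andP[? ?] := h0M (x - y); have /andP[? ?] := phi01 x.
by rewrite (le_trans _ (_ : h (x - y) <= M))// ler_piMl.
Qed.

Lemma cut_kernel_integrable nu y :
  nu.-integrable setT (EFin \o (fun x => phi x * h (x - y))).
Proof.
apply: (@bounded_integrable _ _ _ _ _ M).
  by apply: continuous_measurable_rV; exact: continuous_cut_kernel.
by move=> x; rewrite ger0_norm.
Qed.

Lemma cut_potential_ge0 nu y : 0 <= cut_potential nu y.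
Proof. by apply: Rintegral_ge0 => x _. Qed.

Lemma cut_potential_leM nu y : cut_potential nu y <= M.
Proof.
rewrite -[leRHS](Rintegral_probability_cst nu) le_Rintegral//.
  exact: cut_kernel_integrable.
exact: finite_measure_integrable_cst.
Qed.

(** The constant does not depend on [nu], because [phi] is at most 1 and [nu] has mass 1. *)
Lemma cut_potential_lipschitz nu y z :
  `|cut_potential nu y - cut_potential nu z| <= k * `|y - z|.
Proof.
apply: ler_dist_Rintegral; [exact: cut_kernel_integrable..|move=> x].
rewrite -mulrBr normrM.
have /andP[? ?] := phi01 x.
rewrite (ger0_norm (_ : 0 <= phi x))//.
rewrite (@le_trans _ _ `|h (x - y) - h (x - z)|)//; first by rewrite ler_piMl.
rewrite (le_trans (hk _ _))// (_ : x - y - (x - z) = z - y) 1?distrC//.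
by rewrite opprB addrC addrA subrK.
Qed.

Lemma continuous_cut_potential nu : continuous (cut_potential nu).
Proof. exact: lipschitz_continuous_rV (cut_potential_lipschitz nu). Qed.

Lemma cut_potential_integrable nu nu' :
  nu'.-integrable setT (EFin \o (fun y => phi y * cut_potential nu y)).
Proof.
apply: (@bounded_integrable _ _ _ _ _ M).
  apply: continuous_measurable_rV => y.
  exact: (continuousM (@cphi y) (@continuous_cut_potential nu y)).
move=> y; have /andP[? ?] := phi01 y.
rewrite ger0_norm ?mulr_ge0 ?cut_potential_ge0//.
by rewrite (le_trans _ (cut_potential_leM nu y))// ler_piMl// cut_potential_ge0.
Qed.

Lemma weak_star_cvg_Rintegral (mu_ : nat -> probability 'rV[R]_N R)
    (mu : probability 'rV[R]_N R) (f : 'rV[R]_N -> R) :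
  weak_star_cvg mu_ mu -> continuous f -> compact (closure [set x | f x != 0]) ->
  mu.-integrable setT (EFin \o f) ->
  \int[mu_ n]_x f x @[n --> \oo] --> \int[mu]_x f x.
Proof.
move=> mumu cf Kf fi; apply: fine_cvg.
by rewrite -EFin_Rintegral//; exact: mumu.
Qed.

(* The potentials of the [mu_ n] are equi-Lipschitz, so that their pointwise
   convergence is uniform on the support of [phi]. *)
Lemma cvg_cut_energy (mu_ : nat -> probability 'rV[R]_N R)
    (mu : probability 'rV[R]_N R) : weak_star_cvg mu_ mu ->
  cut_energy (mu_ n) @[n --> \oo] --> cut_energy mu.
Proof.
move=> mumu; apply/cvgrPdist_le => e e0.
have e4 : 0 < e / 4 by rewrite divr_gt0.
(* Over a distance [d] each potential varies by at most [e / 8]; two variations and the error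
   [e / 4] at the centre add up to [e / 2]. *)
pose d := e / 8 / (`|k| + 1).
have k1 : 0 < `|k| + 1 by rewrite ltr_wpDl.
have d0 : 0 < d by rewrite !divr_gt0.
have [|n0 _ hn0] := iffLR (compact_near_coveringP _) Kphi nat \oo
    (fun n y => `|cut_potential mu y - cut_potential (mu_ n) y| <= e / 2) _.
  move=> y _.
  have := weak_star_cvg_Rintegral mumu (@continuous_cut_kernel y)
    (compact_support_mulr Kphi) (cut_kernel_integrable mu y).
  move=> /cvgrPdist_le /(_ _ e4) hy.
  exists (ball y d, [set n |
      `|cut_potential mu y - cut_potential (mu_ n) y| <= e / 4]).
    by split => //=; exact: nbhsx_ballx.
  move=> [z n] /= []; rewrite -ball_normE /= => yz.
  have close nu : `|cut_potential nu y - cut_potential nu z| <= e / 8.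
    rewrite (le_trans (cut_potential_lipschitz nu y z))//.
    rewrite (@le_trans _ _ ((`|k| + 1) * d))//; last first.
      by rewrite /d mulrC divfK// gt_eqF.
    by rewrite ler_pM//; [rewrite ler_wpDr// ler_norm|exact: ltW].
  have := close mu; have := close (mu_ n); rewrite !ler_norml.
  by move=> /andP[? ?] /andP[? ?] /andP[? ?]; apply/andP; split; lra.
have := weak_star_cvg_Rintegral mumu _ (compact_support_mulr Kphi)
  (cut_potential_integrable mu mu).
move=> /(_ _)/cvgrPdist_le => /(_ _ _ (divr_gt0 e0 (ltr0n _ 2)))[|n1 _ hn1].
  by move=> y; exact: (continuousM (@cphi y) (@continuous_cut_potential mu y)).
exists (maxn n0 n1) => // n /=; rewrite geq_max => /andP[n0n n1n].
have := hn1 n n1n; rewrite /=.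
(* Exchanging the potential of [mu_ n] for that of [mu] leaves the integral of a fixed test
   function, to which weak-* convergence applies. *)
have : `|\int[mu_ n]_y (phi y * cut_potential mu y) - cut_energy (mu_ n)| <= e / 2.
  apply: ler_dist_Rintegral; [exact: cut_potential_integrable..|move=> y].
  have [yK|yK] := pselect (closure [set x | phi x != 0] y).
    rewrite -mulrBr normrM (le_trans _ (hn0 n n0n y yK))// ler_piMl//.
    by have /andP[? ?] := phi01 y; rewrite ger0_norm.
  rewrite (_ : phi y = 0) ?mul0r ?subrr ?normr0 ?divr_ge0 ?ltW//.
  by apply: contrapT => /eqP fy; apply: yK; exact: subset_closure.
rewrite !ler_norml /cut_energy => /andP[? ?] /andP[? ?].
by apply/andP; split; lra.
Qed.

End double_integral.

(** * From regularized energies to the lower bound *)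

Section liminf.
Context {R : realType} {N : nat}.
Variable f : 'rV[R]_N -> \bar R.
Hypothesis f0 : forall z, (0 <= f z)%E.

Let cut_energy_k k := cut_energy (@cutoff R N k) (inf_conv f k).

Let cutoff01 k (x : 'rV[R]_N) : 0 <= cutoff k x <= 1.
Proof. by rewrite cutoff_ge0 cutoff_le1. Qed.

Let inf_conv0k k x : 0 <= inf_conv f k x <= k%:R.
Proof. by rewrite inf_conv_ge0//= inf_conv_le_nat. Qed.

Let cut_kernel_integrable_k k (nu : probability 'rV[R]_N R) y : nu.-integrable setT
  (EFin \o (fun x : 'rV[R]_N => cutoff k x * inf_conv f k (x - y))) :=
  cut_kernel_integrable (@continuous_cutoff _ _ k) (cutoff01 k) (inf_conv0k k)
    (inf_conv_lipschitz f0 k) nu y.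

Let cut_potential_integrable_k k (nu nu' : probability 'rV[R]_N R) :
  nu'.-integrable setT (EFin \o (fun y => cutoff k y * cut_potential (cutoff k) (inf_conv f k) nu y)) :=
  cut_potential_integrable (@continuous_cutoff _ _ k) (cutoff01 k) (inf_conv0k k)
    (inf_conv_lipschitz f0 k) nu nu'.

Lemma Rintegral_empirical n (x : 'I_n -> 'rV[R]_N) (mu : probability 'rV[R]_N R)
    (u : 'rV[R]_N -> R) :
  is_empirical x mu -> measurable_fun setT u -> (forall z, 0 <= u z) ->
  \int[mu]_z u z = n%:R^-1 * \sum_(i < n) u (x i).
Proof.
move=> xmu mu_ u0; rewrite /Rintegral (ge0_integral_empirical xmu)//.
- by rewrite sumEFin.
- exact/measurable_EFinP.
Qed.

(** The double integral also counts the [n.+1] diagonal terms, each at most [k], whence the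
    correction after division by [n.+1 ^ 2]. Off the diagonal the cut kernel lies below [f]. *)
Lemma cut_energy_empirical_le k n (x : 'I_n.+1 -> 'rV[R]_N)
    (mu : probability 'rV[R]_N R) : (forall z, f (- z) = f z) ->
  is_empirical x mu ->
  ((cut_energy_k k mu - k%:R / n.+1%:R)%:E <= pair_energy f x)%E.
Proof.
move=> fC xmu.
pose u i j := cutoff k (x i) * (cutoff k (x j) * inf_conv f k (x j - x i)).
have u0 i j : 0 <= u i j by rewrite !mulr_ge0 ?cutoff_ge0 ?inf_conv_ge0.
have JE : cut_energy_k k mu = (n.+1%:R ^+ 2)^-1 * \sum_i \sum_j u i j.
  rewrite /cut_energy_k /cut_energy (Rintegral_empirical xmu).
  - rewrite expr2 invfM -mulrA; congr (_ * _).
    rewrite mulr_sumr; apply: eq_bigr => i _.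
    rewrite /cut_potential (Rintegral_empirical xmu).
    + by rewrite mulrCA -mulr_sumr.
    + by have /measurable_int/measurable_EFinP := cut_kernel_integrable_k k mu (x i).
    + by move=> z; rewrite mulr_ge0 ?cutoff_ge0 ?inf_conv_ge0.
  - by have /measurable_int/measurable_EFinP := cut_potential_integrable_k k mu mu.
  - move=> z; rewrite mulr_ge0 ?cutoff_ge0//.
    exact: cut_potential_ge0 (cutoff01 k) (inf_conv0k k) _ _.
have diag : \sum_i u i i <= n.+1%:R * k%:R.
  rewrite -[X in X%:R * _]card_ord mulr_natl -sumr_const; apply: ler_sum => i _.
  have /andP[? ?] := cutoff01 k (x i); have /andP[? ?] := inf_conv0k k (x i - x i).
  rewrite -[leRHS]mul1r ler_pM// ?mulr_ge0//.
  by rewrite -[leRHS]mul1r ler_pM.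
have off : ((\sum_i \sum_(j | j != i) u i j)%:E <=
    \sum_(i < n.+1) \sum_(j < n.+1 | j != i) f (x i - x j)%R)%E.
  rewrite -sumEFin; apply: lee_sum => i _; rewrite -sumEFin; apply: lee_sum => j _.
  (* Symmetry reconciles the order of the two points in the integral with that in [pair_energy]. *)
  rewrite -(fC (x i - x j)) opprB; apply: le_trans (inf_conv_le_fun f0 k _).
  have /andP[? ?] := cutoff01 k (x i); have /andP[? ?] := cutoff01 k (x j).
  have ? : 0 <= inf_conv f k (x j - x i) by exact: inf_conv_ge0.
  rewrite lee_fin /u
    (le_trans (_ : _ <= cutoff k (x j) * inf_conv f k (x j - x i)))//.
    by rewrite ler_piMl// mulr_ge0.
  by rewrite ler_piMl.
rewrite /pair_energy; apply: (@le_trans _ _ (((n.+1%:R ^+ 2)^-1)%:E *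
    (\sum_i \sum_(j | j != i) u i j)%:E)%E); last first.
  by rewrite lee_pmul2l// lte_fin invr_gt0 exprn_gt0.
rewrite -EFinM lee_fin JE.
have -> : k%:R / n.+1%:R = (n.+1%:R ^+ 2)^-1 * (n.+1%:R * k%:R) :> R.
  by field; rewrite addrC natr1 pnatr_eq0.
rewrite -mulrBr ler_wpM2l ?invr_ge0 ?exprn_ge0//.
rewrite lerBlDr (le_trans _ (lerD (lexx _) diag))// -big_split/=.
by apply: ler_sum => i _; rewrite (bigD1 i)//= addrC.
Qed.

(** Fatou's lemma on the product space: for large [k] both cutoffs equal 1 at a given pair of
    points, and the regularized kernel exceeds any real number below [f]. *)
Lemma energy_le_liminf_cut_energy (mu : probability 'rV[R]_N R) :
  lower_semicontinuous f ->
  (energy f mu <= limn_einf (fun k => (cut_energy_k k mu)%:E))%E.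
Proof.
move=> lscf.
have mf := lower_semicontinuous_measurable_rV lscf.
pose F (p : 'rV[R]_N * 'rV[R]_N) := f (p.1 - p.2).
have mF : measurable_fun setT F := measurableT_comp mf measurable_subr_rV.
pose G k (p : 'rV[R]_N * 'rV[R]_N) : \bar R :=
  (cutoff k p.2 * (cutoff k p.1 * inf_conv f k (p.1 - p.2)))%:E.
have mG k : measurable_fun setT (G k).
  apply/measurable_EFinP; apply: measurable_funM.
    apply: (measurableT_comp _ measurable_snd).
    by apply: continuous_measurable_rV; exact: continuous_cutoff.
  apply: measurable_funM.
    apply: (measurableT_comp _ measurable_fst).
    by apply: continuous_measurable_rV; exact: continuous_cutoff.
  apply: (measurableT_comp _ measurable_subr_rV).
  by apply: continuous_measurable_rV; exact: continuous_inf_conv.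
have G0 k p : (0 <= G k p)%E.
  by rewrite lee_fin !mulr_ge0 ?cutoff_ge0 ?inf_conv_ge0.
have GE k : (cut_energy_k k mu)%:E = (\int[(mu \x mu)%E]_p G k p)%E.
  rewrite fubini_tonelli2// /cut_energy_k /cut_energy.
  rewrite -EFin_Rintegral; last exact: cut_potential_integrable_k.
  apply: eq_integral => y _.
  rewrite EFinM /cut_potential -EFin_Rintegral; last exact: cut_kernel_integrable_k.
  rewrite -ge0_integralZl//.
  - by have /measurable_int := cut_kernel_integrable_k k mu y.
  - by move=> x _; rewrite lee_fin mulr_ge0 ?cutoff_ge0 ?inf_conv_ge0.
  - by rewrite lee_fin cutoff_ge0.
rewrite (_ : energy f mu = \int[(mu \x mu)%E]_p F p)%E; last first.
  by rewrite (fubini_tonelli2 _ mF (fun p => f0 _)).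
under [in leRHS]eq_fun do rewrite GE.
apply: le_trans (fatou _ _ _ _) => //.
apply: ge0_le_integral => //.
- by move=> p _; exact: f0.
- rewrite /limn_einf; apply: measurableT_comp => //.
  apply: measurable_fun_limn_esup => k; exact: measurableT_comp.
- move=> p _; apply: le_limn_einf => a aF.
  near=> k.
  rewrite /G (_ : cutoff k p.2 = 1); last by near: k; exact: cutoff_eventually1.
  rewrite (_ : cutoff k p.1 = 1); last by near: k; exact: cutoff_eventually1.
  rewrite !mul1r lee_fin; near: k; exact: inf_conv_eventually_ge.
Unshelve. all: by end_near. Qed.

End liminf.

Lemma energy_le_liminf (R : realType) (N : nat) (g : 'rV[R]_N -> \bar R) (c : R)
    (mu : probability 'rV[R]_N R) (mu_ : nat -> probability 'rV[R]_N R) :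
  0 <= c -> (forall z, (- c)%:E <= g z)%E -> (forall z, g (- z) = g z) ->
  lower_semicontinuous g -> weak_star_cvg mu_ mu ->
  (energy g mu <= limn_einf (fun n => discrete_energy g n (mu_ n)))%E.
Proof.
move=> c0 gc gC lscg mumu.
pose f z := (g z + c%:E)%E.
have f0 z : (0 <= f z)%E by rewrite /f -leeBlDr// sub0e -EFinN.
have lscf : lower_semicontinuous f.
  move=> x a; rewrite /f -lteBlDr// -EFinB => /lscg [V Vx gV].
  by exists V => // y /gV; rewrite EFinB lteBlDr.
have mg := lower_semicontinuous_measurable_rV lscg.
pose J k nu : R := cut_energy (@cutoff R N k) (inf_conv f k) nu.
set L := limn_einf _.
(* With [k] fixed, [n] tends to infinity: the diagonal correction vanishes, and indices where the
   measure is not [n]-discrete have infinite discrete energy. *)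
have JL k : ((J k mu)%:E <= L + c%:E)%E.
  rewrite -leeBlDr// -EFinB.
  apply: (@limn_einf_ge _ _ (fun n => (J k (mu_ n) - k%:R / n%:R - c)%:E)).
    exists 1%N => // n /= n1; rewrite /discrete_energy.
    case: pselect => [d|_]; last exact: leey.
    case: (cid d) => x /= xmu; case: n => // n in n1 d x xmu *.
    have /(cut_energy_empirical_le f0 k)/(_ xmu) : forall z, f (- z) = f z.
      by move=> z; rewrite /f gC.
    rewrite /f pair_energy_addr => le_pair; rewrite EFinB leeBlDr//.
    apply: (le_trans le_pair).
    (* The discrete energy gains only a fraction of [c] from the shift, so bounding that gain by [c]
       suffices. *)
    rewrite leeD2l// lee_fin -[leRHS]mul1r ler_wpM2r//.
    by rewrite ler_pdivrMr// mul1r ler_nat.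
  rewrite -cvg_shiftS; apply: cvg_EFin; first exact: nearW.
  apply: cvgB; last exact: cvg_cst.
  rewrite -[X in _ --> X]subr0; apply: cvgB.
    rewrite (cvg_shiftS (fun n => J k (mu_ n))); apply: cvg_cut_energy mumu.
    - exact: continuous_cutoff.
    - exact: compact_support_cutoff.
    - by move=> x; rewrite cutoff_ge0 cutoff_le1.
    - by move=> x; rewrite inf_conv_ge0//=; exact: inf_conv_le_nat.
    - exact: ler0n.
    - exact: inf_conv_lipschitz.
  rewrite -[X in _ --> X](mulr0 k%:R); apply: cvgMl_tmp; exact: cvg_harmonic.
(* Now [k] tends to infinity, the bound [L + c%:E] being uniform in [k]. *)
rewrite -(@leeD2rE _ c%:E)// -energy_addr_cst//.
apply: le_trans (energy_le_liminf_cut_energy f0 mu lscf) _.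
rewrite (le_trans (limn_einf_sup _))//.
apply: (@limn_esup_le _ _ (cst (L + c%:E))%E); last exact: cvg_cst.
by apply: nearW => k; exact: JL.
Qed.

(** * Gamma-convergence and eventual discreteness of recovery sequences *)

Local Open Scope ereal_scope.

(** The upper limit is the infimum of the suprema of the tails, so some tail has a supremum below
    [+oo]. *)
Lemma limn_esup_lty_near (R : realType) (u : nat -> \bar R) :
  limn_esup u < +oo -> \forall n \near \oo, u n < +oo.
Proof.
rewrite limn_esup_lim (cvg_lim _ (@cvg_esups_inf _ u))// => /ereal_inf_lt.
move=> [_ [m _ <-] um]; exists m => // n /= mn.
by apply: le_lt_trans um; apply: ereal_sup_ubound; exists n.
Qed.

Theorem theorem5 (R : realType) (N : nat) (hN : (1 <= N)%N)
    (g : 'rV[R]_N -> \bar R)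
    (g_real : forall x : 'rV[R]_N, x != 0%R -> g x \is a fin_num)
    (g0 : g 0%R != -oo)
    (g_sym : forall x : 'rV[R]_N, g (- x)%R = g x)
    (g_bounded : bounded_from_below g)
    (g_lsc : lower_semicontinuous g)
    (g_loc : loc_integrable g) :
  gamma_cvg weak_star_cvg (discrete_energy g) (energy g) /\
  (forall (mu : probability 'rV[R]_N R) (mu_ : nat -> probability 'rV[R]_N R),
     energy g mu < +oo ->
     recovery_sequence weak_star_cvg (discrete_energy g) (energy g) mu_ mu ->
     \forall n \near \oo, n_discrete n (mu_ n)).
Proof.
have [c0 gc0] := g_bounded.
pose c := Num.max 0%R (- c0)%R.
have c_ge0 : (0 <= c)%R by rewrite le_max lexx.
have gc z : (- c)%:E <= g z.
  by rewrite (le_trans _ (gc0 z))// lee_fin lerNl le_max lexx orbT.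
have mg := lower_semicontinuous_measurable_rV g_lsc.
split; first split=> [mu mu_ mumu|mu].
- exact: energy_le_liminf c_ge0 gc g_sym g_lsc mumu.
- exact: exists_recovery_sequence c_ge0 mg gc.
- move=> mu mu_ Efin [_ mu_sup].
  apply: filterS (limn_esup_lty_near (le_lt_trans mu_sup Efin)) => n.
  (* A value below [+oo] excludes the branch of [discrete_energy] for measures that are not
     [n]-discrete. *)
  by rewrite /discrete_energy; case: pselect.
Qed.
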